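(* Let $\Omega\subset X$ be an open set, let $u_k\in BV_{\mathrm{loc}}(\Omega)$, $k\in\mathbb{N}$, be a sequence of functions of least gradient in $\Omega$, and suppose that $u$ is a function in $\Omega$ such that $u_k\to u$ in $L^1_{\mathrm{loc}}(\Omega)$. Then $u$ is a function of least gradient in $\Omega$.
   Context: Standing assumptions: $(X,d,\mu)$ is a complete metric space with a Borel regular outer measure $\mu$ that is doubling: there is $c_d>0$ with $0<\mu(B(x,2r))\le c_d\,\mu(B(x,r))<\infty$ for every ball $B(x,r)=\{y\in X: d(y,x)<r\}$ (in particular $X$ is proper). $X$ supports a $(1,1)$-Poincaré inequality: there are $c_P>0$, $\lambda\ge 1$ such that for every ball $B(x,r)$, every locally integrable function $u$ and every upper gradient $g$ of $u$, $\frac{1}{\mu(B(x,r))}\int_{B(x,r)}|u-u_{B(x,r)}|\,d\mu\le c_P\, r\,\frac{1}{\mu(B(x,\lambda r))}\int_{B(x,\lambda r)}g\,d\mu$, where $u_{B}=\frac1{\mu(B)}\int_B u\,d\mu$. Upper gradients: a nonnegative Borel function $g$ is an upper gradient of an extended real-valued function $u$ if for every rectifiable curve $\gamma$ (defined on a compact interval) with end points $x,y$, $|u(x)-u(y)|\le\int_\gamma g\,ds$ when $u(x),u(y)$ are both finite, and $\int_\gamma g\,ds=\infty$ otherwise. $N^{1,1}(X)$ is the space of functions with $\|u\|_{L^1(X)}+\inf_g\|g\|_{L^1(X)}<\infty$ (infimum over upper gradients $g$ of $u$); $N^{1,1}(\Omega)$ is defined similarly for open $\Omega\subset X$. $\Omega'\Subset\Omega$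 means $\Omega'$ is open and $\overline{\Omega'}$ is a compact subset of $\Omega$; the subscript ''loc'' means the property holds on every $\Omega'\Subset\Omega$. Total variation: for open $\Omega\subset X$ and $u\in L^1_{\mathrm{loc}}(\Omega)$, $\|Du\|(\Omega)=\inf\{\liminf_{i\to\infty}\int_\Omega g_{u_i}\,d\mu:\ u_i\in N^{1,1}_{\mathrm{loc}}(\Omega),\ u_i\to u\text{ in }L^1_{\mathrm{loc}}(\Omega)\}$, where $g_{u_i}$ is an upper gradient of $u_i$ in $\Omega$. For an arbitrary set $A$, $\|Du\|(A)$ is the infimum of $\|Du\|(U)$ over open sets $U\supset A$ (contained in the domain of $u$). $u\in BV(\Omega)$ means $u\in L^1(\Omega)$ and $\|Du\|(\Omega)<\infty$. $BV_c(\Omega)$ is the set of $g\in BV(X)$ with compact support in $\Omega$. A function $u\in BV_{\mathrm{loc}}(\Omega)$ is of least gradient in $\Omega$ if for every $g\in BV_c(\Omega)$ with support $K=\mathrm{supt}(g)$, $\|Du\|(K)\le\|D(u+g)\|(K)$. *)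

(* Defs.v *)
From HB Require Import structures.
From mathcomp Require Import all_boot all_order all_algebra.
From mathcomp Require Import all_classical all_reals all_analysis.
From mathcomp Require Import measurable_realfun.

Set Implicit Arguments.
Unset Strict Implicit.
Unset Printing Implicit Defensive.

Import Order.TTheory GRing.Theory Num.Theory.
Import numFieldNormedType.Exports.

Local Open Scope classical_set_scope.
Local Open Scope ring_scope.
Local Open Scope ereal_scope.

(* Complete includes a distinguished point: measurable types are pointed, so
   the caratheodory_type of an outer measure requires a nonempty space. *)
#[short(type="completeMetricType")]
HB.structure Definition CompleteMetric (K : numDomainType) :=
  {T of Complete T & Metric K T}.

Section curves.
Context {R : realType} {X : completeMetricType R}.
Implicit Types (gamma : R -> X) (a b : R).

Definition curve_length a b gamma : \bar R :=
  ereal_sup [set (\sum_(0 <= i < size s)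
      mdist (gamma (nth b (a :: s) i)) (gamma (nth b (a :: s) i.+1)))%R%:E
    | s in itv_partition a b].

Definition rectifiable_curve a b gamma :=
  [/\ (a <= b)%R, {within `[a, b], continuous gamma} &
      curve_length a b gamma < +oo].

(* If s_gamma(t) is the length of gamma on [a, t], this is the curve gamma_s
   with gamma = gamma_s \o s_gamma; it is determined on [0, length of gamma],
   gamma being constant on the level sets of s_gamma. *)
Definition arclength_param a b gamma (s : R) : X :=
  gamma (inf [set t | t \in `[a, b] /\ s%:E <= curve_length a t gamma]).

Definition curve_integral a b gamma (g : X -> \bar R) : \bar R :=
  \int[lebesgue_measure]_(s in `[0%R, fine (curve_length a b gamma)])
    g (arclength_param a b gamma s).

Definition upper_gradient_ineq a b gamma (u g : X -> \bar R) : Prop :=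
  if (u (gamma a) \is a fin_num) && (u (gamma b) \is a fin_num)
  then is_true (`|u (gamma a) - u (gamma b)| <= curve_integral a b gamma g)
  else curve_integral a b gamma g = +oo.

(* Constant curves are admitted, so a function having an upper gradient is
   finite everywhere. Excluding them would not change the total variation:
   resetting u to 0 where it is infinite (a null set if u is integrable)
   preserves its upper gradients. *)
Definition upper_gradient (Omega : set X) (u g : X -> \bar R) :=
  [/\ forall x, Omega x -> 0 <= g x,
      measurable_fun (Omega : set (g_sigma_algebraType (@open X)))
        (g : g_sigma_algebraType (@open X) -> \bar R) &
      forall a b gamma, rectifiable_curve a b gamma ->
        (forall t, t \in `[a, b] -> Omega (gamma t)) ->
        upper_gradient_ineq a b gamma u g].

End curves.

Section metric_measure_space.
Context {R : realType} {X : completeMetricType R}.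
Variable mu : {outer_measure set X -> \bar R}.
Implicit Types (Omega U A : set X) (u g : X -> \bar R).

Definition borel_regular :=
  <<s @open X >> `<=` mu.-caratheodory /\
  forall A, exists B, [/\ <<s @open X >> B, A `<=` B & mu B = mu A].

Definition doubling := exists2 c : R, (0 < c)%R &
  forall x r, (0 < r)%R ->
    [/\ 0 < mu (ball x (2 * r)%R),
        mu (ball x (2 * r)%R) <= c%:E * mu (ball x r) &
        c%:E * mu (ball x r) < +oo].

Definition compactly_inside Omega' Omega :=
  [/\ open Omega', compact (closure Omega') & closure Omega' `<=` Omega].

(* mu.-measurability and integration are those of the Caratheodory
   sigma-algebra of mu. *)
Definition mu_int A u : \bar R :=
  \int[mu : set (caratheodory_type mu) -> \bar R]_(x in A) u x.

Definition L1 Omega u : bool :=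
  (mu : set (caratheodory_type mu) -> \bar R).-integrable Omega u.

Definition L1loc Omega u :=
  forall Omega', compactly_inside Omega' Omega -> L1 Omega' u.

Definition L1loc_cvg Omega (u_ : nat -> X -> \bar R) u :=
  [/\ forall i, L1loc Omega (u_ i), L1loc Omega u &
      forall Omega', compactly_inside Omega' Omega ->
        mu_int Omega' (fun x => `|u_ i x - u x|) @[i --> \oo] --> 0].

Definition average A u : \bar R := (fine (mu A))^-1%:E * mu_int A u.

Definition poincare11 := exists cP lambda : R,
  [/\ (0 < cP)%R, (1 <= lambda)%R &
    forall x r u g, (0 < r)%R -> L1loc setT u -> upper_gradient setT u g ->
      average (ball x r) (fun y => `|u y - average (ball x r) u|) <=
      cP%:E * r%:E * average (ball x (lambda * r)%R) g].

Definition N11 Omega u :=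
  measurable_fun (Omega : set (caratheodory_type mu))
    (u : caratheodory_type mu -> \bar R) /\
  mu_int Omega (fun x => `|u x|) +
    ereal_inf [set mu_int Omega g | g in upper_gradient Omega u] < +oo.

Definition N11loc Omega u :=
  forall Omega', compactly_inside Omega' Omega -> N11 Omega' u.

Definition open_variation Omega u : \bar R :=
  ereal_inf [set v | exists u_ g_ : nat -> X -> \bar R,
    [/\ forall i, N11loc Omega (u_ i),
        L1loc_cvg Omega u_ u,
        forall i, upper_gradient Omega (u_ i) (g_ i) &
        v = limn_einf (fun i => mu_int Omega (g_ i))]].

(* Omega is the open set on which u is defined. *)
Definition variation Omega u A : \bar R :=
  ereal_inf [set open_variation U u | U in
    [set U | [/\ open U, A `<=` U & U `<=` Omega]]].

Definition BV Omega u := L1 Omega u /\ open_variation Omega u < +oo.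

Definition BVloc Omega u :=
  forall Omega', compactly_inside Omega' Omega -> BV Omega' u.

Definition fun_support g : set X := closure [set x | g x != 0].

Definition BVc Omega g :=
  [/\ BV setT g, compact (fun_support g) & fun_support g `<=` Omega].

Definition least_gradient Omega u :=
  BVloc Omega u /\
  forall g, BVc Omega g ->
    variation Omega u (fun_support g) <=
    variation Omega (fun x => u x + g x) (fun_support g).

End metric_measure_space.

(* Main.v *)
From HB Require Import structures.
Require Import Defs.
From mathcomp Require Import all_boot all_order all_algebra.
From mathcomp Require Import all_classical all_reals all_analysis.
From mathcomp Require Import measurable_realfun.
From mathcomp Require Import ring lra.

(** Write V(U, f) for the variation of f on an open set U. Everything follows
    from one estimate ([competitor]). Let w be of least gradient in Omega, let v
    have finite variation on an open set U contained in Omega, and let rho be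
    1-Lipschitz with {a <= rho} a compact subset of U. Then
      V({6a < rho}, w) <= V(U, v) + 1/a * int_{2a < rho < 5a} |v - w|.
    Take w = u_k. With v = 0 this is a Caccioppoli inequality: the variation of
    u_k is controlled locally by its L1 norm, hence bounded in k, and lower
    semicontinuity ([lower_semicontinuity]) shows that u is locally BV. With
    v = u + g and rho so large on the support K of g that 6a < rho there, the
    function g vanishes on the layer {2a < rho < 5a}, so the integral is that of
    |u - u_k| and tends to 0. Lower semicontinuity then gives V(A, u) <=
    V(U, u + g) for some open A containing K, and U may be any open neighbourhood
    of K, so that taking the infimum over U gives minimality.

    For the estimate, test the minimality of w with the competitor
    eta v + (1 - eta) w, where the cutoff eta is 1 for rho >= 4a and 0 for
    rho <= 3a. On a small neighbourhood W of the support of the perturbation, the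
    Leibniz rule [open_variation_glue] bounds its variation by
      V(W, v) + V(W and rho < 6a, w) + 1/a * int |v - w|,
    whereas V(W, w) >= V({6a < rho}, w) + V(W and rho < 6a, w) because disjoint
    open sets do not interact ([open_variation_disjoint]); the common term is
    finite and cancels. Least gradient compares variations on the support of the
    perturbation only, so this support has to be known. Adding to v a small
    constant e, which leaves its variation unchanged, makes the perturbation
    nonzero on a countable dense subset of {3a < rho}; its support is then the
    closure of {3a < rho} ([perturbation_support]).

    The Leibniz rule comes down to a statement on upper gradients. If F =
    eta v + (1 - eta) w with eta L-Lipschitz, then for any three points x, y, z
    the difference F(x) - F(y) is a combination of increments of v and w between
    x, z and y, plus (eta(x) - eta(y)) (v(z) - w(z)). Along a curve of length l
    from x to y this gives |F(x) - F(y)| <= int (g_v + g_w) + L l |v - w|(z) for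
    every z on the curve, and averaging over z shows that g_v + g_w + L |v - w| is
    an upper gradient ([convex_combination_le]). Away from the layer F is v or w,
    and being an upper gradient is a local property ([upper_gradient_local])
    because lengths and line integrals are additive ([curve_integralD]). Upper
    gradients must be Borel, whence the majorants of [borel_envelope].

    Local compactness, needed for cutoffs and exhaustions, follows from
    completeness and the doubling condition ([closure_ball_compact]). *)

Set Implicit Arguments.
Unset Strict Implicit.
Unset Printing Implicit Defensive.

Import Order.TTheory GRing.Theory Num.Theory.
Import numFieldNormedType.Exports.

Local Open Scope classical_set_scope.
Local Open Scope ring_scope.
Local Open Scope ereal_scope.

Local Notation borel_fun D g := (measurable_fun
  (D : set (g_sigma_algebraType (@open _)))
  (g : g_sigma_algebraType (@open _) -> \bar _)).

(** * Lengths of curves *)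

Section curve_length.
Context {R : realType} {X : completeMetricType R}.
Implicit Types (a b c : R) (s : seq R) (gamma : R -> X).

Fixpoint polygon_length gamma a s : R :=
  if s is x :: s' then (mdist (gamma a) (gamma x) + polygon_length gamma x s')%R
  else 0%R.

Lemma polygon_lengthE gamma a b s :
  (\sum_(0 <= i < size s)
     mdist (gamma (nth b (a :: s) i)) (gamma (nth b (a :: s) i.+1)))%R
  = polygon_length gamma a s.
Proof.
elim: s a => [|x s ih] a /=; first by rewrite big_geq.
by rewrite big_nat_recl//= -ih.
Qed.

Lemma polygon_length_ge0 gamma a s : (0 <= polygon_length gamma a s)%R.
Proof. by elim: s a => //= x s ih a; rewrite addr_ge0// mdist_ge0. Qed.

Lemma polygon_length_cat gamma a s t :
  polygon_length gamma a (s ++ t) =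
  (polygon_length gamma a s + polygon_length gamma (last a s) t)%R.
Proof. by elim: s a => [|x s ih] a /=; rewrite ?add0r// ih addrA. Qed.

Lemma curve_lengthE gamma a b : curve_length a b gamma =
  ereal_sup [set (polygon_length gamma a s)%:E | s in itv_partition a b].
Proof.
rewrite /curve_length; congr ereal_sup; apply/seteqP; split => _ [s sab <-];
  by exists s => //; rewrite polygon_lengthE.
Qed.

(** Inserting [c] as a vertex can only lengthen the polygon, by the triangle
    inequality. *)
Lemma polygon_length_split gamma a b c s : (a <= c)%R -> (c <= b)%R ->
  itv_partition a b s -> exists s1 s2,
  [/\ itv_partition a c s1, itv_partition c b s2 &
      (polygon_length gamma a s <=
       polygon_length gamma a s1 + polygon_length gamma c s2)%R].
Proof.
elim: s a => [|x s ih] a ac cb.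
  move=> /itv_partition_nil ab; subst b.
  have <- : a = c by apply/eqP; rewrite eq_le ac cb.
  by exists [::], [::]; split=> //=; rewrite addr0.
move=> /[dup] /itv_partition_cons xs [/=/andP[ax _] _].
have [cx|xc] := ltP c x.
  move: ac; rewrite le_eqVlt => /orP[/eqP <-|ac].
    exists [::], (x :: s); split=> //=; last by rewrite add0r.
    by case: xs => xs1 xs2; split=> //=; rewrite ax.
  exists [:: c], (x :: s); split=> /=; first exact: itv_partition1.
    by case: xs => xs1 xs2; split=> //=; rewrite cx.
  by rewrite addr0 addrA lerD2r metric_triangle.
have [s1 [s2 [p1 p2 l]]] := ih x xc cb xs.
exists (x :: s1), s2; split=> //=; last by rewrite -addrA lerD2l.
by case: p1 => p11 p12; split=> //=; rewrite ax.
Qed.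

Lemma itv_partition_exists a b : (a <= b)%R -> exists s, itv_partition a b s.
Proof.
rewrite le_eqVlt => /orP[/eqP <-|ab]; first by exists [::]; split.
by exists [:: b]; exact: itv_partition1.
Qed.

Lemma curve_length_ge0 gamma a b : (a <= b)%R -> 0 <= curve_length a b gamma.
Proof.
move=> ab; rewrite curve_lengthE.
have [s sab] := itv_partition_exists ab.
apply: (@le_trans _ _ (polygon_length gamma a s)%:E).
  by rewrite lee_fin polygon_length_ge0.
by apply: ereal_sup_ubound; exists s.
Qed.

Lemma mdist_le_curve_length gamma a b : (a <= b)%R ->
  (mdist (gamma a) (gamma b))%:E <= curve_length a b gamma.
Proof.
rewrite le_eqVlt => /orP[/eqP <-|ab].
  by rewrite mdistxx curve_length_ge0.
rewrite curve_lengthE; apply: ereal_sup_ubound; exists [:: b].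
  exact: itv_partition1.
by rewrite /= addr0.
Qed.

Lemma curve_lengthxx gamma a : curve_length a a gamma = 0.
Proof.
apply/eqP; rewrite eq_le curve_length_ge0// andbT curve_lengthE.
by apply: ge_ereal_sup => _ [s /itv_partitionxx -> <-].
Qed.

Lemma curve_lengthD gamma a b c : (a <= c)%R -> (c <= b)%R ->
  curve_length a b gamma = curve_length a c gamma + curve_length c b gamma.
Proof.
move=> ac cb; apply/eqP; rewrite eq_le; apply/andP; split.
  rewrite [leLHS]curve_lengthE; apply: ge_ereal_sup => _ [s sab <-].
  have [s1 [s2 [p1 p2 l]]] := polygon_length_split gamma ac cb sab.
  apply: (@le_trans _ _ ((polygon_length gamma a s1)%:E +
      (polygon_length gamma c s2)%:E)); first by rewrite -EFinD lee_fin.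
  by rewrite !curve_lengthE leeD//; apply: ereal_sup_ubound;
    [exists s1|exists s2].
have [->|Lfin] := eqVneq (curve_length a b gamma) +oo; first exact: leey.
have H s t : itv_partition a c s -> itv_partition c b t ->
    (polygon_length gamma a s)%:E + (polygon_length gamma c t)%:E <=
    curve_length a b gamma.
  move=> sac tcb; rewrite -EFinD curve_lengthE; apply: ereal_sup_ubound.
  exists (s ++ t); first exact: itv_partition_cat sac tcb.
  by rewrite polygon_length_cat; case: sac => _ /eqP ->.
have H1 s : itv_partition a c s ->
    (polygon_length gamma a s)%:E + curve_length c b gamma <=
    curve_length a b gamma.
  move=> sac; rewrite addeC -leeBrDr// [leLHS]curve_lengthE.
  by apply: ge_ereal_sup => _ [t tcb <-]; rewrite leeBrDr// addeC H.
have Lcb : curve_length c b gamma \is a fin_num.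
  rewrite ge0_fin_numE ?curve_length_ge0//.
  have [s sac] := itv_partition_exists ac.
  apply: (@le_lt_trans _ _ (curve_length a b gamma)); last by rewrite ltey.
  by apply: le_trans (H1 _ sac); rewrite leeDr// lee_fin polygon_length_ge0.
rewrite -leeBrDr// [leLHS]curve_lengthE.
by apply: ge_ereal_sup => _ [s sac <-]; rewrite leeBrDr// H1.
Qed.

Lemma rectifiable_subcurve gamma a b c d : (a <= c)%R -> (c <= d)%R ->
  (d <= b)%R -> rectifiable_curve a b gamma -> rectifiable_curve c d gamma.
Proof.
move=> ac cd db [_ cont fin]; split=> //.
  apply: continuous_subspaceW cont => t /=; rewrite !in_itv/= => /andP[ct td].
  by rewrite (le_trans ac ct) (le_trans td db).
apply: le_lt_trans fin.
rewrite (@curve_lengthD _ a b c) ?(le_trans cd)// (@curve_lengthD _ c b d)//.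
have ? := curve_length_ge0 gamma ac; have ? := curve_length_ge0 gamma db.
by rewrite addeCA leeDl// adde_ge0.
Qed.

(** [arclength_param] is [gamma] composed with this function. It is
    nondecreasing, which is why the arclength parametrisation is measurable. *)
Definition arclength_time a b gamma (s : R) : R :=
  inf [set t | t \in `[a, b] /\ s%:E <= curve_length a t gamma].

Section arclength.
Variables (a b : R) (gamma : R -> X).
Hypothesis rect : rectifiable_curve a b gamma.

Let ab : (a <= b)%R. Proof. by case: rect. Qed.

Lemma curve_length_fin_num c d : (a <= c)%R -> (c <= d)%R -> (d <= b)%R ->
  curve_length c d gamma \is a fin_num.
Proof.
move=> ac cd db; rewrite ge0_fin_numE ?curve_length_ge0//.
by have [] := rectifiable_subcurve ac cd db rect.
Qed.

Let S (s : R) := [set t | t \in `[a, b] /\ s%:E <= curve_length a t gamma].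

Let S_lb (s : R) : lbound (S s) a.
Proof. by move=> t [] /=; rewrite in_itv/= => /andP[]. Qed.

Lemma arclength_time_in (s : R) : (s <= fine (curve_length a b gamma))%R ->
  arclength_time a b gamma s \in `[a, b].
Proof.
move=> sl; have Sb : S s b.
  split; first by rewrite in_itv/= ab lexx.
  by rewrite -[leRHS]fineK ?lee_fin// curve_length_fin_num.
rewrite in_itv/=; apply/andP; split.
  by apply: lb_le_inf; [exists b|exact: S_lb].
by apply: ge_inf Sb; exists a; exact: S_lb.
Qed.

Lemma arclength_time_nondecreasing (s t : R) :
  (s <= t)%R -> (t <= fine (curve_length a b gamma))%R ->
  (arclength_time a b gamma s <= arclength_time a b gamma t)%R.
Proof.
move=> st tl; apply: lb_le_inf.
  exists b; split; first by rewrite in_itv/= ab lexx.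
  by rewrite -[leRHS]fineK ?lee_fin// curve_length_fin_num.
move=> r [rab tr]; apply: ge_inf; first by exists a; exact: S_lb.
by split=> //; apply: le_trans tr; rewrite lee_fin.
Qed.

Lemma measurable_arclength_param :
  measurable_fun `[0%R, fine (curve_length a b gamma)]
    (arclength_param a b gamma : measurableTypeR R -> g_sigma_algebraType (@open X)).
Proof.
set l := fine _; apply: (@measurability _ _ _ (g_sigma_algebraType (@open X)) _ _ (@open X)) => //.
move=> _ [U oU <-].
case: rect => _ cont _.
have /open_subspaceP[V oV Veq] := (continuousP _).1 cont U oU.
rewrite (_ : _ `&` _ = `[0%R, l] `&` (arclength_time a b gamma @^-1` V)).
  have : measurable V by exact: open_measurable.
  apply: (_ : measurable_fun `[0%R, l] (arclength_time a b gamma)) => //.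
  apply: (measurability (@RGenCInfty.G R)) => [|/= _ [_] [r] -> <-].
    exact: RGenCInfty.measurableE.
  apply: is_interval_measurable => s t/=.
  rewrite !in_itv/= !andbT => -[/andP[s0 _] rs] [/andP[_ tl] rt] u /andP[su ut].
  split; first by rewrite in_itv/= (le_trans s0 su) (le_trans ut tl).
  rewrite in_itv/= andbT (le_trans rs)// arclength_time_nondecreasing//.
  exact: le_trans ut tl.
apply/seteqP; split => s [] /=; rewrite in_itv/= => /andP[s0 sl] Us.
  split; first by rewrite s0.
  have : (V `&` `[a, b]) (arclength_time a b gamma s).
    by rewrite Veq; split; [exact: Us|exact: (arclength_time_in sl)].
  by case.
split; first by rewrite s0.
have : (V `&` `[a, b]) (arclength_time a b gamma s).
  by split; [exact: Us|exact: (arclength_time_in sl)].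
by rewrite Veq; case.
Qed.

End arclength.

End curve_length.

(** * Integrals along curves *)

Section translation.
Context {R : realType}.
Local Notation leb := lebesgue_measure.

Let shift_measurable (c : R) :
  measurable_fun setT ((fun s => s + c)%R : measurableTypeR R -> measurableTypeR R).
Proof. exact: measurable_funD. Qed.

Lemma lebesgue_measure_shift (c : R) (A : set (measurableTypeR R)) :
  measurable A ->
  pushforward leb ((fun s => s + c)%R : measurableTypeR R -> measurableTypeR R) A
  = leb A.
Proof.
pose phi := ((fun s => s + c)%R : measurableTypeR R -> measurableTypeR R).
pose phiM : {mfun measurableTypeR R >-> measurableTypeR R} :=
  HB.pack phi (isMeasurableFun.Build _ _ _ _ phi (@shift_measurable c)).
move=> mA; apply/esym.
apply: (@lebesgue_measure_unique _ (pushforward leb phiM)) => // _ [[x y]] _ <-.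
change (leb `]x, y] = leb (phiM @^-1` `]x, y])).
have -> : phiM @^-1` `]x, y]%classic = `](x - c)%R, (y - c)%R]%classic.
  by apply/seteqP; split => z /=; rewrite !in_itv/= ltrBlDr lerBrDr.
rewrite !lebesgue_measure_itv/= !lte_fin ltrD2r; case: ifPn => // _.
by rewrite -!EFinB; congr (_%:E); lra.
Qed.

Lemma ge0_integral_shift (c : R) (D : set R) (f : R -> \bar R) :
  measurable D -> measurable_fun D f -> (forall s, D s -> 0 <= f s) ->
  \int[leb]_(s in D) f s = \int[leb]_(s in [set s | D (s + c)%R]) f (s + c)%R.
Proof.
move=> mD mf f0.
rewrite -(ge0_integral_pushforward (@shift_measurable c))//.
  apply: eq_measure_integral => A mA _; exact/esym/lebesgue_measure_shift.
by move=> s /set_mem; exact: f0.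
Qed.

End translation.

Lemma curve_integralxx (R : realType) (X : completeMetricType R)
  (gamma : R -> X) (c : R) g : curve_integral c c gamma g = 0.
Proof. by rewrite /curve_integral curve_lengthxx/= set_itv1 integral_set1. Qed.

Section curve_integral.
Context {R : realType} {X : completeMetricType R}.
Variables (a b : R) (gamma : R -> X) (Omega : set X) (g : X -> \bar R).
Hypothesis rect : rectifiable_curve a b gamma.
Hypothesis open_Omega : open Omega.
Hypothesis gamma_in : forall t, t \in `[a, b] -> Omega (gamma t).
Hypothesis g_ge0 : forall x, Omega x -> 0 <= g x.
Hypothesis g_meas : borel_fun Omega g.

Let ab : (a <= b)%R. Proof. by case: rect. Qed.
Let l c d := fine (curve_length c d gamma).

Lemma arclength_param_in s : (s <= l a b)%R -> Omega (arclength_param a b gamma s).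
Proof. by move=> sl; apply/gamma_in/(arclength_time_in rect). Qed.

Lemma measurable_comp_arclength (f : X -> \bar R) :
  borel_fun Omega f ->
  measurable_fun `[0%R, l a b] (fun s => f (arclength_param a b gamma s)).
Proof.
move=> mf.
apply: (@measurable_comp _ _ _ _ (g_sigma_algebraType (@open X)) _ Omega f) => //.
- exact: sub_sigma_algebra.
- move=> _ [s /= + <-]; rewrite in_itv/= => /andP[_ sl].
  exact: arclength_param_in.
- exact: measurable_arclength_param.
Qed.

Lemma curve_integral_ge0 : 0 <= curve_integral a b gamma g.
Proof.
apply: integral_ge0 => s /=; rewrite in_itv/= => /andP[_ sl].
exact/g_ge0/arclength_param_in.
Qed.

End curve_integral.

Section curve_integral_split.
Context {R : realType} {X : completeMetricType R}.
Variables (a b : R) (gamma : R -> X) (Omega : set X) (g : X -> \bar R).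
Hypothesis rect : rectifiable_curve a b gamma.
Hypothesis open_Omega : open Omega.
Hypothesis gamma_in : forall t, t \in `[a, b] -> Omega (gamma t).
Hypothesis g_ge0 : forall x, Omega x -> 0 <= g x.
Hypothesis g_meas : borel_fun Omega g.

Let ab : (a <= b)%R. Proof. by case: rect. Qed.
Let l c d := fine (curve_length c d gamma).

Variable c : R.
Hypotheses (ac : (a <= c)%R) (cb : (c <= b)%R).

Let labE : l a b = (l a c + l c b)%R.
Proof.
rewrite /l (curve_lengthD gamma ac cb) fineD//.
  exact: (curve_length_fin_num rect).
exact: (curve_length_fin_num rect).
Qed.

Let l_ge0 d e : (d <= e)%R -> (0 <= l d e)%R.
Proof. by move=> de; apply/fine_ge0/curve_length_ge0. Qed.

Let le_l d e s : (a <= d)%R -> (d <= e)%R -> (e <= b)%R ->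
  (s%:E <= curve_length d e gamma) = (s <= l d e)%R.
Proof.
by move=> *; rewrite -lee_fin /l fineK// (curve_length_fin_num rect).
Qed.

Lemma arclength_param_left s : (s <= l a c)%R ->
  arclength_param a c gamma s = arclength_param a b gamma s.
Proof.
move=> sl; rewrite /arclength_param; congr gamma.
set S := [set t | _]; set T := [set t | _].
have Sc : S c by split; [rewrite in_itv/= ac lexx|rewrite le_l].
have Ta t : T t -> (a <= t)%R by case; rewrite in_itv/= => /andP[].
have ST : S `<=` T.
  move=> t [+ st]; rewrite in_itv/= => /andP[at_ tc]; split => //.
  by rewrite in_itv/= at_ (le_trans tc).
apply/eqP; rewrite eq_le; apply/andP; split.
  apply: lb_le_inf; first by exists c; exact: ST.
  move=> t [tab st]; have [tc|ct] := leP t c.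
    apply: ge_inf; first by exists a => u /ST /Ta.
    by split=> //; move: tab; rewrite !in_itv/= tc => /andP[->].
  apply: le_trans (ltW ct); apply: ge_inf Sc; by exists a => u /ST /Ta.
apply: lb_le_inf; first by exists c.
by move=> t /ST Tt; apply: ge_inf Tt; exists a => u /Ta.
Qed.

(** Restarting the curve at [c] shifts the arclength. At [s = 0] the two infima
    may differ: the length of [gamma] up to [c] can already be reached before [c]. *)
Lemma arclength_param_right s : (0 < s)%R -> (s <= l c b)%R ->
  arclength_param c b gamma s = arclength_param a b gamma (s + l a c).
Proof.
move=> s0 sl; rewrite /arclength_param; congr (gamma (inf _)).
apply/seteqP; split => t [] /=; rewrite !in_itv/= => /andP[t1 t2].
  rewrite le_l// => st; rewrite (le_trans ac t1) t2; split=> //.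
  rewrite (curve_lengthD gamma ac t1) EFinD addeC leeD//.
    by rewrite le_l// (le_trans t1).
  by rewrite le_l.
rewrite le_l// => st.
have ct : (c <= t)%R.
  rewrite leNgt; apply/negP => tc; move: st; apply/negP; rewrite -ltNge.
  have : (l a t <= l a c)%R.
    rewrite -le_l// /l fineK ?(curve_length_fin_num rect)// ?(ltW tc)//.
    rewrite (curve_lengthD gamma t1 (ltW tc)) leeDl// curve_length_ge0//.
    exact: ltW.
  by move=> h; rewrite (le_lt_trans h)// ltrDr.
rewrite ct t2; split=> //; rewrite le_l//.
move: st; rewrite /l (curve_lengthD gamma ac ct) fineD.
- by rewrite addrC lerD2l.
- exact: (curve_length_fin_num rect).
- exact: (curve_length_fin_num rect).
Qed.

Lemma curve_integralD : curve_integral a b gamma g =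
  curve_integral a c gamma g + curve_integral c b gamma g.
Proof.
set G := fun s => g (arclength_param a b gamma s).
have mG : measurable_fun `[0%R, l a b] G.
  exact: (measurable_comp_arclength rect open_Omega gamma_in).
have G0 s : (s <= l a b)%R -> 0 <= G s.
  move=> sl; apply: g_ge0; exact: (@arclength_param_in _ _ a b gamma Omega).
have mH : measurable_fun `[0%R, l c b]
    (fun s => g (arclength_param c b gamma s)).
  have rcb : rectifiable_curve c b gamma by exact: rectifiable_subcurve rect.
  apply: (measurable_comp_arclength rcb open_Omega) => // t.
  rewrite in_itv/= => /andP[ct tb]; apply: gamma_in.
  by rewrite in_itv/= tb (le_trans ac).
have Gl := arclength_param_left; have Gr := arclength_param_right.
have lac : (0 <= l a c)%R by exact: l_ge0.
have lcb : (0 <= l c b)%R by exact: l_ge0.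
move: labE; rewrite /curve_integral -/(l a b) -/(l a c) -/(l c b).
(* from here on, only the additivity of the three lengths matters *)
move: (l a b) (l a c) (l c b) mG G0 mH Gl Gr lac lcb.
move=> lab lac lcb mG G0 mH Gl Gr lac0 lcb0 labE'.
have lE : `[0%R, lab]%classic = `[0%R, lac] `|` `]lac, lab].
  by rewrite -itv_bndbnd_setU// bnd_simp// labE' lerDl.
rewrite -/G lE ge0_integral_setU; last 5 first.
- exact: measurable_itv.
- exact: measurable_itv.
- by rewrite -lE.
- by move=> s; rewrite -lE/= in_itv/= => /andP[_ /G0].
- apply/disj_setPS => s /=; rewrite !in_itv/= => -[/andP[_ h1] /andP[h2 _]].
  by move: (lt_le_trans h2 h1); rewrite ltxx.
apply: (f_equal2 adde).
  apply: eq_integral => s; rewrite inE/= in_itv/= => /andP[_ sl].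
  by rewrite /G -Gl.
rewrite (ge0_integral_shift lac (D := `]lac, lab]%classic)); last 3 first.
- exact: measurable_itv.
- have sub : `]lac, lab] `<=` `[0%R, lab]%classic.
    by rewrite lE; exact: subsetUr.
  exact: (measurable_funS (measurable_itv _) sub mG).
- by move=> s /=; rewrite in_itv/= => /andP[_ /G0].
have -> : [set s | `]lac, lab]%classic (s + lac)%R] = `]0%R, lcb]%classic.
  by apply/seteqP; split => s /=; rewrite !in_itv/= labE' ltrDr (addrC s) lerD2l.
transitivity (\int[lebesgue_measure]_(s in `]0%R, lcb])
  g (arclength_param c b gamma s)).
  apply: eq_integral => s; rewrite inE/= in_itv/= => /andP[s0 sl].
  by rewrite /G Gr.
apply: integral_itv_obnd_cbnd.
have sub : `]0%R, lcb] `<=` `[0%R, lcb]%classic.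
  by move=> s /=; rewrite !in_itv/= => /andP[/ltW -> ->].
exact: (measurable_funS (measurable_itv _) sub mH).
Qed.

End curve_integral_split.

(** * Upper gradients are local *)

#[local] Opaque curve_integral curve_length.

Section local_to_global.
Context {R : realType}.

(** Continuous induction: the supremum of the [t] with [P a t] is [b]. *)
Lemma interval_chain (P : R -> R -> Prop) (a b : R) : (a <= b)%R ->
  (forall c d e, (a <= c)%R -> (c <= d)%R -> (d <= e)%R -> (e <= b)%R ->
    P c d -> P d e -> P c e) ->
  (forall t, (a <= t <= b)%R -> exists2 e, (0 < e)%R & forall c d,
    (a <= c)%R -> (c <= d)%R -> (d <= b)%R ->
    (`|c - t| < e)%R -> (`|d - t| < e)%R -> P c d) ->
  P a b.
Proof.
move=> ab trans loc.
pose S := [set t | (a <= t <= b)%R /\ P a t].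
have Sa : S a.
  split; first by rewrite lexx.
  have [|e e0 /(_ a a)] := loc a; first by rewrite lexx.
  by rewrite subrr normr0; exact.
have Sb t : S t -> (t <= b)%R by case=> /andP[].
have supS : has_sup S by split; [exists a|exists b => t /Sb].
have as_ : (a <= sup S)%R by apply: ub_le_sup => //; exists b => t /Sb.
have sb : (sup S <= b)%R by apply: ge_sup => //; exists a.
have [|e e0 He] := loc (sup S); first by rewrite as_.
have [t St tS] := sup_adherent e0 supS.
have ts : (t <= sup S)%R by apply: ub_le_sup => //; exists b => ? /Sb.
case: (St) => /andP[a_t tb] Pt.
pose d := Num.min b (sup S + e / 2)%R.
have e2 : (0 < e / 2)%R by rewrite divr_gt0.
have td : (t <= d)%R by rewrite le_min tb/=; lra.
have Pd : P a d.
  apply: (trans _ t) => //; first by rewrite ge_min lexx.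
  apply: He => //; first by rewrite ge_min lexx.
    by rewrite ler0_norm ?subr_le0//; lra.
  rewrite ltr_norml; apply/andP; split; rewrite /d; case: (leP b (sup S + e/2)%R); lra.
have ds : (d <= sup S)%R.
  apply: ub_le_sup; first by exists b => ? /Sb.
  by split=> //; rewrite (le_trans a_t td)/= ge_min lexx.
move: ds Pd; rewrite /d; case: (leP b (sup S + e / 2)%R) => //; lra.
Qed.

End local_to_global.


Section upper_gradients.
Context {R : realType} {X : completeMetricType R}.
Implicit Types (Omega U : set X) (u v w g : X -> \bar R) (gamma : R -> X).

(** The constant curve at [x] has length zero, so the second alternative of
    [upper_gradient_ineq] is excluded. *)
Lemma upper_gradient_finite Omega u g x :
  upper_gradient Omega u g -> Omega x -> u x \is a fin_num.
Proof.
move=> [_ _ /(_ 0%R 0%R (cst x))] H Omx.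
have rect : rectifiable_curve 0 0 (cst x : R -> X).
  split => //; last by rewrite curve_lengthxx.
  apply: continuous_subspaceT; exact: cst_continuous.
have /(_ rect (fun _ _ => Omx)) := H.
rewrite /upper_gradient_ineq; case: ifPn => [/andP[]//|_].
by rewrite curve_integralxx.
Qed.

Lemma upper_gradient_le Omega u g a b gamma :
  upper_gradient Omega u g -> rectifiable_curve a b gamma ->
  (forall t, t \in `[a, b] -> Omega (gamma t)) ->
  `|u (gamma a) - u (gamma b)| <= curve_integral a b gamma g.
Proof.
move=> ug rect gin; case: (rect) => ab _ _.
case: (ug) => _ _ /(_ a b gamma rect gin).
rewrite /upper_gradient_ineq !(upper_gradient_finite ug)//.
- by apply: gin; rewrite in_itv/= lexx ab.
- by apply: gin; rewrite in_itv/= lexx ab.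
Qed.

Lemma upper_gradientS Omega U u g : open U -> open Omega -> U `<=` Omega ->
  upper_gradient Omega u g -> upper_gradient U u g.
Proof.
move=> oU oO UO [g0 mg ug]; split.
- by move=> x /UO /g0.
- by apply: measurable_funS mg => //; exact: sub_sigma_algebra.
- by move=> a b gamma rect gin; apply: ug => // t /gin /UO.
Qed.

(** Being an upper gradient is a local property: a curve is cut into finitely
    many pieces on which the inequality is known, and both sides add up. *)
Lemma upper_gradient_local Omega u g : open Omega ->
  (forall x, Omega x -> 0 <= g x) ->
  borel_fun Omega g ->
  (forall x, Omega x -> u x \is a fin_num) ->
  (forall x, Omega x -> exists U, [/\ open U, U x & forall a b gamma,
    rectifiable_curve a b gamma ->
    (forall t, t \in `[a, b] -> (Omega `&` U) (gamma t)) ->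
    `|u (gamma a) - u (gamma b)| <= curve_integral a b gamma g]) ->
  upper_gradient Omega u g.
Proof.
move=> oO g0 mg fu loc; split=> // a b gamma rect gin.
have [ab cont _] := rect.
have gin' t : (a <= t)%R -> (t <= b)%R -> Omega (gamma t).
  by move=> a_t tb; apply: gin; rewrite in_itv/= a_t.
rewrite /upper_gradient_ineq !fu/=; [|exact: gin'|exact: gin'].
apply: (interval_chain (P := fun c d =>
  is_true (`|u (gamma c) - u (gamma d)| <= curve_integral c d gamma g)) ab).
  move=> c d e ac cd de eb h1 h2.
  have rce : rectifiable_curve c e gamma.
    exact: (rectifiable_subcurve ac (le_trans cd de) eb rect).
  have -> : curve_integral c e gamma g =
      curve_integral c d gamma g + curve_integral d e gamma g.
    apply: (curve_integralD rce oO _ g0 mg cd de) => t; rewrite in_itv/= => /andP[ct te].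
    by apply: gin'; [exact: le_trans ct|exact: le_trans eb].
  apply: le_trans (leeD h1 h2).
  have fd := fu _ (gin' d (le_trans ac cd) (le_trans de eb)).
  have -> : u (gamma c) - u (gamma e) =
      (u (gamma c) - u (gamma d)) + (u (gamma d) - u (gamma e)).
    by rewrite addeA subeK.
  exact: lee_abs_add.
move=> t /andP[a_t tb].
have [U [oU Ut HU]] := loc _ (gin' t a_t tb).
have /open_subspaceP[V oV Veq] := (continuousP _).1 cont U oU.
have inV s : (a <= s)%R -> (s <= b)%R -> V s -> U (gamma s).
  move=> a_s sb Vs; have : (V `&` `[a, b]) s by split=> //; rewrite /= in_itv/= a_s.
  by rewrite Veq => -[].
have Vt : V t.
  have : (from_subspace `[a, b] gamma @^-1` U `&` `[a, b]) t.
    by split=> //; rewrite /= in_itv/= a_t.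
  by rewrite -Veq => -[].
have /nbhs_ballP[e e0 He] : nbhs t V by exact: open_nbhs_nbhs.
exists e => // c d ac cd db ct dt.
apply: HU; first exact: (rectifiable_subcurve ac cd db rect).
move=> s; rewrite in_itv/= => /andP[cs sd].
have a_s := le_trans ac cs; have sb := le_trans sd db.
split; first exact: gin'.
apply: inV => //; apply: He; rewrite /ball/= distrC.
by move: ct dt; rewrite !ltr_norml; lra.
Qed.


Lemma lee_curve_integral a b gamma Omega f g : open Omega ->
  rectifiable_curve a b gamma ->
  (forall t, t \in `[a, b] -> Omega (gamma t)) ->
  (forall x, Omega x -> 0 <= f x) -> (forall x, Omega x -> f x <= g x) ->
  borel_fun Omega f ->
  borel_fun Omega g ->
  curve_integral a b gamma f <= curve_integral a b gamma g.
Proof.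
move=> oO rect gin f0 fg mf mg.
have inO s : `[0%R, fine (curve_length a b gamma)]%classic s ->
    Omega (arclength_param a b gamma s).
  rewrite /= in_itv/= => /andP[_ sl].
  exact: (@arclength_param_in _ _ a b gamma Omega).
apply: ge0_le_integral.
- exact: measurable_itv.
- by move=> s /inO /f0.
- exact: (measurable_comp_arclength rect oO gin).
- exact: (measurable_comp_arclength rect oO gin).
- by move=> s /inO /fg.
Qed.

Lemma curve_integral_add a b gamma Omega f g : open Omega ->
  rectifiable_curve a b gamma ->
  (forall t, t \in `[a, b] -> Omega (gamma t)) ->
  (forall x, Omega x -> 0 <= f x) -> (forall x, Omega x -> 0 <= g x) ->
  borel_fun Omega f ->
  borel_fun Omega g ->
  curve_integral a b gamma (fun x => f x + g x) =
  curve_integral a b gamma f + curve_integral a b gamma g.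
Proof.
move=> oO rect gin f0 g0 mf mg.
have inO s : `[0%R, fine (curve_length a b gamma)]%classic s ->
    Omega (arclength_param a b gamma s).
  rewrite /= in_itv/= => /andP[_ sl].
  exact: (@arclength_param_in _ _ a b gamma Omega).
apply: ge0_integralD.
- exact: measurable_itv.
- by move=> s /inO /f0.
- exact: (measurable_comp_arclength rect oO gin).
- by move=> s /inO /g0.
- exact: (measurable_comp_arclength rect oO gin).
Qed.

Lemma curve_integral_ge_cst a b gamma Omega f c : open Omega ->
  rectifiable_curve a b gamma ->
  (forall t, t \in `[a, b] -> Omega (gamma t)) ->
  borel_fun Omega f ->
  (0 <= c)%R -> (forall t, t \in `[a, b] -> c%:E <= f (gamma t)) ->
  c%:E * curve_length a b gamma <= curve_integral a b gamma f.
Proof.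
move=> oO rect gin mf c0 cf; have [ab _ _] := rect.
have l0 := curve_length_ge0 gamma ab.
have lfin : curve_length a b gamma \is a fin_num.
  exact: (curve_length_fin_num rect).
have <- : \int[lebesgue_measure]_(s in `[0%R, fine (curve_length a b gamma)])
    (cst c%:E s) = c%:E * curve_length a b gamma.
  rewrite integral_cst//= lebesgue_measure_itv/= lte_fin.
  case: ifPn => [_|]; first by rewrite oppr0 adde0 fineK.
  by rewrite -leNgt => h; congr (_ * _); rewrite -[RHS]fineK//;
    congr EFin; apply/eqP; rewrite eq_le h fine_ge0.
apply: ge0_le_integral.
- exact: measurable_itv.
- by move=> s _; rewrite lee_fin.
- exact: measurable_cst.
- exact: (measurable_comp_arclength rect oO gin).
- move=> s /=; rewrite in_itv/= => /andP[_ sl]; apply: cf.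
  exact: (arclength_time_in rect).
Qed.

End upper_gradients.

(** * Calculus of upper gradients *)

Section upper_gradient_calculus.
Context {R : realType} {X : completeMetricType R}.
Implicit Types (A B U : set X) (u v w g : X -> \bar R) (gamma : R -> X).

Lemma upper_gradientB U v w gv gw : open U ->
  upper_gradient U v gv -> upper_gradient U w gw ->
  upper_gradient U (fun x => v x - w x) (fun x => gv x + gw x).
Proof.
move=> oU ugv ugw; have [gv0 mgv _] := ugv; have [gw0 mgw _] := ugw.
split; first by move=> x Ux; rewrite adde_ge0 ?gv0 ?gw0.
  by apply: emeasurable_funD.
move=> a b gamma rect gin; have [ab _ _] := rect.
have Ua : U (gamma a) by apply: gin; rewrite in_itv/= lexx.
have Ub : U (gamma b) by apply: gin; rewrite in_itv/= lexx ab.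
have := upper_gradient_finite ugv Ua; have := upper_gradient_finite ugv Ub.
have := upper_gradient_finite ugw Ua; have := upper_gradient_finite ugw Ub.
have := upper_gradient_le ugv rect gin; have := upper_gradient_le ugw rect gin.
rewrite /upper_gradient_ineq (curve_integral_add oU rect gin gv0 gw0 mgv mgw).
case: (v (gamma a)) (v (gamma b)) (w (gamma a)) (w (gamma b)) =>
  [va||] [vb||] [wa||] [wb||]//= hw hv _ _ _ _.
apply: le_trans (leeD hv hw); rewrite -EFinD lee_fin.
have -> : (va - wa + - (vb - wb) = (va - vb) - (wa - wb))%R by ring.
exact: ler_normB.
Qed.

Lemma upper_gradient_cst U (c : R) : open U -> upper_gradient U (cst c%:E) (cst 0).
Proof.
move=> oU; split; [by []|exact: measurable_cst|].
move=> a b gamma rect gin; rewrite /upper_gradient_ineq/= subrr normr0.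
exact: (@curve_integral_ge0 _ _ _ _ _ U).
Qed.

(** The increments of [v] and [w] pass through an arbitrary intermediate point
    [z]; only the value of [v - w] at [z] is multiplied by the increment of the
    cutoff. *)
Let convex_split (ex ey vx vy vz wx wy wz L l iv iw : R) :
  (0 <= ex <= 1)%R -> (0 <= ey <= 1)%R -> (`|ex - ey| <= L * l)%R ->
  (`|vx - vz| + `|vz - vy| <= iv)%R -> (`|wx - wz| + `|wz - wy| <= iw)%R ->
  (`|(ex * vx + (1 - ex) * wx) - (ey * vy + (1 - ey) * wy)|
    <= iv + iw + L * l * `|vz - wz|)%R.
Proof.
move=> /andP[ex0 ex1] /andP[ey0 ey1] el hv hw.
have -> : (ex * vx + (1 - ex) * wx - (ey * vy + (1 - ey) * wy) =
  (ex * (vx - vz) + ey * (vz - vy)) + ((1 - ex) * (wx - wz) +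
  (1 - ey) * (wz - wy)) + (ex - ey) * (vz - wz))%R by ring.
have le1 (e d : R) : (0 <= e)%R -> (e <= 1)%R -> (`|e * d| <= `|d|)%R.
  by move=> e0 e1; rewrite normrM (ger0_norm e0) ler_piMl.
apply: le_trans (ler_normD _ _) _; apply: lerD; last first.
  by rewrite normrM ler_wpM2r.
apply: le_trans (ler_normD _ _) _; apply: lerD.
  apply: le_trans hv; apply: le_trans (ler_normD _ _) _.
  by apply: lerD; apply: le1.
apply: le_trans hw; apply: le_trans (ler_normD _ _) _.
by apply: lerD; apply: le1; lra.
Qed.

Let upper_gradient_add_le U u g a b gamma t : open U ->
  upper_gradient U u g -> rectifiable_curve a b gamma ->
  (forall t, t \in `[a, b] -> U (gamma t)) -> t \in `[a, b] ->
  `|u (gamma a) - u (gamma t)| + `|u (gamma t) - u (gamma b)|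
  <= curve_integral a b gamma g.
Proof.
move=> oU ug rect gin; rewrite in_itv/= => /andP[a_t tb].
have [g0 mg _] := ug.
rewrite (curve_integralD rect oU gin g0 mg a_t tb); apply: leeD.
  apply: (upper_gradient_le ug (rectifiable_subcurve _ a_t tb rect)) => //.
  move=> s; rewrite in_itv/= => /andP[as_ st]; apply: gin.
  by rewrite in_itv/= as_ (le_trans st).
apply: (upper_gradient_le ug (rectifiable_subcurve a_t tb _ rect)) => //.
move=> s; rewrite in_itv/= => /andP[ts sb]; apply: gin.
by rewrite in_itv/= sb (le_trans a_t).
Qed.

(** The Leibniz estimate holds for every intermediate point of the curve, so that
    [v - w] may be replaced by its mean along the curve. *)
Lemma convex_combination_le U v w gv gw h (eta : X -> R) (L : R) a b gamma :
  open U -> (0 <= L)%R -> (forall x, 0 <= eta x <= 1)%R ->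
  (forall x y, `|eta x - eta y| <= L * mdist x y)%R ->
  upper_gradient U v gv -> upper_gradient U w gw -> borel_fun U h ->
  (forall x, U x -> `|v x - w x| <= h x) ->
  rectifiable_curve a b gamma -> (forall t, t \in `[a, b] -> U (gamma t)) ->
  `|((eta (gamma a))%:E * v (gamma a) + (1 - eta (gamma a))%:E * w (gamma a)) -
    ((eta (gamma b))%:E * v (gamma b) + (1 - eta (gamma b))%:E * w (gamma b))| <=
  curve_integral a b gamma (fun x => gv x + gw x + L%:E * h x).
Proof.
move=> oU L0 eta01 etaL ugv ugw mh vwh rect gin.
have [gv0 mgv _] := ugv; have [gw0 mgw _] := ugw; have [ab _ _] := rect.
have h0 x : U x -> 0 <= h x by move=> Ux; apply: le_trans (vwh _ Ux).
have Lh0 x : U x -> 0 <= L%:E * h x by move=> Ux; rewrite mule_ge0 ?h0.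
have mLh : borel_fun U (fun x => L%:E * h x) by exact: measurable_funeM.
rewrite (curve_integral_add oU rect gin _ Lh0 _ mLh); last 2 first.
- by move=> x Ux; rewrite adde_ge0 ?gv0 ?gw0.
- exact: emeasurable_funD.
rewrite (curve_integral_add oU rect gin gv0 gw0 mgv mgw).
have Iv0 := curve_integral_ge0 rect gin gv0.
have Iw0 := curve_integral_ge0 rect gin gw0.
have Ih0 := curve_integral_ge0 rect gin Lh0.
have addv t := @upper_gradient_add_le U v gv a b gamma t oU ugv rect gin.
have addw t := @upper_gradient_add_le U w gw a b gamma t oU ugw rect gin.
have lfin : curve_length a b gamma \is a fin_num.
  by apply: (curve_length_fin_num rect).
have etal : (`|eta (gamma a) - eta (gamma b)| <= L * fine (curve_length a b gamma))%R.
  apply: le_trans (etaL _ _) _; rewrite ler_wpM2l//.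
  by rewrite -lee_fin fineK// mdist_le_curve_length.
have mean := curve_integral_ge_cst oU rect gin mLh.
have l0 := curve_length_ge0 gamma ab.
have finv t : t \in `[a, b] -> v (gamma t) = (fine (v (gamma t)))%:E.
  by move=> /gin /(upper_gradient_finite ugv) /fineK.
have finw t : t \in `[a, b] -> w (gamma t) = (fine (w (gamma t)))%:E.
  by move=> /gin /(upper_gradient_finite ugw) /fineK.
have aab : a \in `[a, b] by rewrite in_itv/= lexx.
have bab : b \in `[a, b] by rewrite in_itv/= lexx ab.
have {}vwh t : t \in `[a, b] ->
    (`|fine (v (gamma t)) - fine (w (gamma t))|)%:E <= h (gamma t).
  by move=> tab; have := vwh _ (gin _ tab); rewrite (finv t)// (finw t).
rewrite (finv a)// (finv b)// (finw a)// (finw b)//.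
rewrite -!EFinM -!EFinD abse_EFin.
move: lfin l0 etal mean.
move: (curve_length a b gamma) (curve_integral a b gamma gv)
  (curve_integral a b gamma gw) (curve_integral a b gamma (fun x => L%:E * h x))
  Iv0 Iw0 Ih0 addv addw => [l||]//.
move=> Iv Iw Ih Iv0 Iw0 Ih0 addv addw _ l0 etal mean.
have [->|Ivfin] := eqVneq Iv +oo.
  by rewrite addye ?gt_eqF ?(lt_le_trans _ Iw0)// addye ?leey// gt_eqF ?(lt_le_trans _ Ih0).
have [->|Iwfin] := eqVneq Iw +oo.
  by rewrite addey ?gt_eqF ?(lt_le_trans _ Iv0)// addye ?leey// gt_eqF ?(lt_le_trans _ Ih0).
move: Iv Iw Iv0 Iw0 Ivfin Iwfin addv addw => [iv||]// [iw||]// iv0 iw0 _ _ addv addw.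
rewrite lee_fin in l0.
have {}addv t : t \in `[a, b] ->
    (`|fine (v (gamma a)) - fine (v (gamma t))| +
     `|fine (v (gamma t)) - fine (v (gamma b))| <= iv)%R.
  by move=> tab; have := addv t tab; rewrite (finv a)// (finv b)// (finv t).
have {}addw t : t \in `[a, b] ->
    (`|fine (w (gamma a)) - fine (w (gamma t))| +
     `|fine (w (gamma t)) - fine (w (gamma b))| <= iw)%R.
  by move=> tab; have := addw t tab; rewrite (finw a)// (finw b)// (finw t).
have key t (tab : t \in `[a, b]) := convex_split (eta01 (gamma a)) (eta01 (gamma b))
  etal (addv t tab) (addw t tab).
(* If [c] exceeds the integrals of [gv] and [gw], the excess divided by the
   length is a lower bound of [L * h] along the curve. *)
set c := (`|_|)%R in key *.
have [cle|clt] := leP c (iv + iw)%R.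
  rewrite -EFinD; apply: (@le_trans _ _ (iv + iw)%:E); first by rewrite lee_fin.
  by rewrite leeDl.
have lgt0 : (0 < l)%R.
  rewrite lt_neqAle l0 andbT; apply/eqP => l0'.
  by have := key a aab; rewrite -l0' mulr0 mul0r addr0 leNgt clt.
have := mean ((c - (iv + iw)) / l)%R; rewrite -EFinM divfK ?gt_eqF// => H.
rewrite -EFinD addeC -leeBlDr// -EFinB; apply: H; first by rewrite divr_ge0 ?subr_ge0 ?ltW.
move=> t tab; apply: (@le_trans _ _ (L%:E *
    (`|fine (v (gamma t)) - fine (w (gamma t))|)%:E)); last first.
  by apply: lee_wpmul2l; rewrite ?lee_fin ?vwh.
rewrite -EFinM lee_fin ler_pdivrMr// lerBlDl mulrAC.
exact: key.
Qed.

Section glue.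
Variables (A B : set X) (eta : X -> R) (L : R).
Hypotheses (oA : open A) (oB : open B) (L0 : (0 <= L)%R).
Hypothesis eta01 : forall x, (0 <= eta x <= 1)%R.
Hypothesis etaL : forall x y, (`|eta x - eta y| <= L * mdist x y)%R.
Hypothesis eta1 : forall x, A x -> ~ B x -> \forall y \near x, eta y = 1%R.
Hypothesis eta0 : forall x, B x -> ~ A x -> \forall y \near x, eta y = 0%R.

(** Off [A `&` B] the convex combination is locally [v] or [w]; on [A `&` B] the
    Leibniz estimate applies. The weights [eta] and [1 - eta] are not kept in front
    of [gv] and [gw], since the two energies are only added up later. *)
Lemma upper_gradient_glue v w gv gw h :
  upper_gradient A v gv -> upper_gradient B w gw ->
  borel_fun (A `&` B) h -> (forall x, (A `&` B) x -> `|v x - w x| <= h x) ->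
  upper_gradient (A `|` B) (fun x => (eta x)%:E * v x + (1 - eta x)%:E * w x)
    (fun x => (gv \_ A) x + (gw \_ B) x + ((fun y => L%:E * h y) \_ (A `&` B)) x).
Proof.
move=> ugv ugw mh vwh; have [gv0 mgv _] := ugv; have [gw0 mgw _] := ugw.
have oAB : open (A `|` B) by exact: openU.
have oAIB : open (A `&` B) by exact: openI.
have bor (D : set X) : open D -> measurable (D : set (g_sigma_algebraType (@open X))).
  by move=> oD; exact: sub_sigma_algebra.
set G := (X in upper_gradient _ _ X).
have h0 x : (A `&` B) x -> 0 <= L%:E * h x.
  by move=> ABx; rewrite mule_ge0 ?lee_fin// (le_trans _ (vwh _ ABx)).
have gvA0 x : 0 <= (gv \_ A) x by apply: erestrict_ge0 => y /gv0.
have gwB0 x : 0 <= (gw \_ B) x by apply: erestrict_ge0 => y /gw0.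
have hAB0 x : 0 <= ((fun y => L%:E * h y) \_ (A `&` B)) x.
  by apply: erestrict_ge0 => y /h0.
have mrestr (D : set X) (f : X -> \bar R) : open D -> borel_fun D f ->
    borel_fun (A `|` B) (f \_ D).
  move=> oD mf; apply/(measurable_restrict _ (bor _ oD) (bor _ oAB)).
  by apply: measurable_funS mf; [exact: bor|exact: subIsetr].
have mG : borel_fun (A `|` B) G.
  apply: emeasurable_funD; first apply: emeasurable_funD.
  - exact: mrestr.
  - exact: mrestr.
  - by apply: mrestr => //; exact: measurable_funeM.
apply: upper_gradient_local => //.
- by move=> x _; rewrite !adde_ge0.
- move=> x ABx.
  have [vf|nAx] := pselect (A x).
    have fv := upper_gradient_finite ugv vf.
    have [wf|nBx] := pselect (B x).
      have fw := upper_gradient_finite ugw wf.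
      by rewrite fin_numD !fin_numM.
    by rewrite (nbhs_singleton (eta1 vf nBx)) subrr mul0e mul1e adde0.
  have Bx : B x by case: ABx.
  rewrite (nbhs_singleton (eta0 Bx nAx)) subr0 mul0e mul1e add0e.
  exact: (upper_gradient_finite ugw Bx).
move=> x ABx.
have [Ax|nAx] := pselect (A x); last first.
  have Bx : B x by case: ABx.
  have /nbhs_interior := eta0 Bx nAx; set U := interior _ => nU.
  exists (U `&` B); split; [exact/openI/oB/open_interior|by split=> //; exact: nbhs_singleton|].
  move=> a b gamma rect gin; have [ab _ _] := rect.
  have inB t : t \in `[a, b] -> B (gamma t) by move=> /gin[_ []].
  have e0 t : t \in `[a, b] -> eta (gamma t) = 0%R.
    by move=> /gin[_ [/interior_subset]].
  rewrite !e0 ?in_itv/= ?lexx ?ab//.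
  rewrite !subr0 !mul0e !mul1e !add0e.
  apply: le_trans (upper_gradient_le ugw rect inB) _.
  apply: (lee_curve_integral oB rect inB gw0 _ mgw).
    by move=> y By; rewrite /G {2}/patch mem_set// addeC addeA leeDr// adde_ge0.
  by apply: measurable_funS mG; [exact: bor|exact: subsetUr].
have [Bx|nBx] := pselect (B x); last first.
  have /nbhs_interior := eta1 Ax nBx; set U := interior _ => nU.
  exists (U `&` A); split; [exact/openI/oA/open_interior|by split=> //; exact: nbhs_singleton|].
  move=> a b gamma rect gin; have [ab _ _] := rect.
  have inA t : t \in `[a, b] -> A (gamma t) by move=> /gin[_ []].
  have e1 t : t \in `[a, b] -> eta (gamma t) = 1%R.
    by move=> /gin[_ [/interior_subset]].
  rewrite !e1 ?in_itv/= ?lexx ?ab//.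
  rewrite !subrr !mul0e !mul1e !adde0.
  apply: le_trans (upper_gradient_le ugv rect inA) _.
  apply: (lee_curve_integral oA rect inA gv0 _ mgv).
    by move=> y Ay; rewrite /G {1}/patch mem_set// -addeA leeDl// adde_ge0.
  by apply: measurable_funS mG; [exact: bor|exact: subsetUl].
exists (A `&` B); split => // a b gamma rect gin.
have {}gin t : t \in `[a, b] -> (A `&` B) (gamma t) by move=> /gin[].
have ugv' := upper_gradientS oAIB oA (@subIsetl _ A B) ugv.
have ugw' := upper_gradientS oAIB oB (@subIsetr _ A B) ugw.
apply: le_trans (convex_combination_le oAIB L0 eta01 etaL ugv' ugw' mh vwh rect gin) _.
apply: (lee_curve_integral oAIB rect gin).
- by move=> y ABy; rewrite !adde_ge0 ?h0//; case: ABy => ? ?; rewrite ?gv0 ?gw0.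
- by move=> y [Ay By]; rewrite /G /patch !mem_set.
- apply: emeasurable_funD; last exact: measurable_funeM.
  by apply: emeasurable_funD; [case: ugv'|case: ugw'].
- by apply: measurable_funS mG; [exact: bor|move=> y [Ay _]; left].
Qed.

End glue.
End upper_gradient_calculus.

(** * Integration with respect to [mu] *)

(** These inequalities hold for infinite values too: their right-hand sides are
    then infinite. *)
Lemma lee_abs_subD (R : realDomainType) (x y z : \bar R) :
  `|x - z| <= `|x - y| + `|y - z|.
Proof.
move: x y z => [x||] [y||] [z||] //=; rewrite ?leey ?lexx//.
rewrite -EFinD lee_fin; have -> : (x - z = (x - y) + (y - z))%R by ring.
exact: ler_normD.
Qed.

Lemma lee_abs_subB (R : realDomainType) (x y x' y' : \bar R) :
  `|(x - y) - (x' - y')| <= `|x - x'| + `|y - y'|.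
Proof.
move: x y x' y' => [x||] [y||] [x'||] [y'||] //=; rewrite ?leey ?lexx//.
rewrite -EFinD lee_fin.
have -> : (x - y - (x' - y') = (x - x') - (y - y'))%R by ring.
exact: ler_normB.
Qed.

Lemma lee_abs_convex (R : realDomainType) (e : R) (x y x' y' : \bar R) :
  (0 <= e <= 1)%R ->
  `|(e%:E * x + (1 - e)%:E * y) - (e%:E * x' + (1 - e)%:E * y')| <=
  `|x - x'| + `|y - y'|.
Proof.
move=> /andP[e0 e1].
have infty a b : `|a| + `|b| = +oo :> \bar R ->
  forall c : \bar R, `|c| <= `|a| + `|b| by move=> -> c; rewrite leey.
move: x y x' y' => [x||] [y||] [x'||] [y'||]; try by apply: infty.
rewrite -!EFinM -!EFinD /= lee_fin.
have -> : (e * x + (1 - e) * y - (e * x' + (1 - e) * y') =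
  e * (x - x') + (1 - e) * (y - y'))%R by ring.
apply: le_trans (ler_normD _ _) _; rewrite !normrM.
by apply: lerD; rewrite ler_piMl// ger0_norm//; lra.
Qed.

Section measure.
Context {R : realType} {X : completeMetricType R}.
Variable mu : {outer_measure set X -> \bar R}.
Hypothesis mu_regular : borel_regular mu.
Implicit Types (A B D U W : set X) (u v w g : X -> \bar R).

Local Notation muC := (mu : set (caratheodory_type mu) -> \bar R).
Local Notation mu_fun D f := (measurable_fun
  (D : set (caratheodory_type mu)) (f : caratheodory_type mu -> \bar R)).
Local Notation mu_set D := (measurable (D : set (caratheodory_type mu))).

Lemma borel_mu_set D :
  measurable (D : set (g_sigma_algebraType (@open X))) -> mu_set D.
Proof. exact: mu_regular.1. Qed.

Lemma open_borel D : open D -> measurable (D : set (g_sigma_algebraType (@open X))).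
Proof. exact: sub_sigma_algebra. Qed.

Lemma open_mu_set D : open D -> mu_set D.
Proof. by move=> /open_borel /borel_mu_set. Qed.

Lemma borel_mu_fun D f :
  measurable (D : set (g_sigma_algebraType (@open X))) -> borel_fun D f -> mu_fun D f.
Proof. by move=> mD mf _ Y mY; apply: borel_mu_set; exact: mf. Qed.

Lemma L1_fun D f : L1 mu D f -> mu_fun D f.
Proof. exact: measurable_int. Qed.

Lemma L1S D U f : open D -> open U -> U `<=` D -> L1 mu D f -> L1 mu U f.
Proof.
by move=> oD oU UD; apply: integrableS => //; exact: open_mu_set.
Qed.

Lemma mu_int_ge0 D f : (forall x, D x -> 0 <= f x) -> 0 <= mu_int mu D f.
Proof. by move=> f0; apply: integral_ge0. Qed.

Lemma mu_int_le D f g : mu_set D -> (forall x, D x -> 0 <= f x) ->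
  mu_fun D f -> mu_fun D g -> (forall x, D x -> f x <= g x) ->
  mu_int mu D f <= mu_int mu D g.
Proof. by move=> mD f0 mf mg fg; apply: ge0_le_integral. Qed.

Lemma mu_intS D U f : mu_set D -> mu_set U -> U `<=` D ->
  mu_fun D f -> (forall x, D x -> 0 <= f x) -> mu_int mu U f <= mu_int mu D f.
Proof. by move=> mD mU UD mf f0; apply: ge0_subset_integral. Qed.

Lemma mu_intD D f g : mu_set D -> (forall x, D x -> 0 <= f x) ->
  mu_fun D f -> (forall x, D x -> 0 <= g x) -> mu_fun D g ->
  mu_int mu D (fun x => f x + g x) = mu_int mu D f + mu_int mu D g.
Proof. by move=> mD f0 mf g0 mg; apply: ge0_integralD. Qed.

Lemma mu_fun_abs_sub D f g : mu_fun D f -> mu_fun D g ->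
  mu_fun D (fun x => `|f x - g x|).
Proof.
by move=> mf mg; apply: measurableT_comp => //; exact: emeasurable_funB.
Qed.

Lemma mu_int_dominated D f g h : mu_set D -> mu_fun D f -> mu_fun D g ->
  mu_fun D h -> (forall x, D x -> 0 <= f x) ->
  (forall x, D x -> 0 <= g x) -> (forall x, D x -> 0 <= h x) ->
  (forall x, D x -> f x <= g x + h x) ->
  mu_int mu D f <= mu_int mu D g + mu_int mu D h.
Proof.
move=> mD mf mg mh f0 g0 h0 fgh; rewrite -mu_intD//.
by apply: mu_int_le => //; exact: emeasurable_funD.
Qed.

(** Upper gradients have to be Borel while the functions are only
    [mu]-measurable: Borel regularity provides Borel majorants that coincide
    with the function almost everywhere. *)
Lemma borel_envelope D f : mu_set D -> mu D < +oo -> mu_fun D f ->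
  (forall x, D x -> 0 <= f x) ->
  exists h, [/\ borel_fun setT h, forall x, 0 <= h x,
    forall x, D x -> f x <= h x & mu_int mu D h = mu_int mu D f].
Proof.
move=> mD Dfin mf f0.
pose q n : R := if @unpickle rat n is Some r then Num.max 0%R (ratr r) else 0%R.
have q0 n : (0 <= q n)%R by rewrite /q; case: unpickle => // r; rewrite le_max lexx.
pose E n := D `&` [set x | (q n)%:E < f x].
have mE n : mu_set (E n) by exact: emeasurable_fun_o_infty.
have /choice[B HB] n := mu_regular.2 (E n).
have bB n : measurable (B n : set (g_sigma_algebraType (@open X))) by case: (HB n).
(* [h] is the supremum of the rational levels [q n] over Borel hulls [B n] of the
   superlevel sets; it exceeds [f] only on the null sets [B n `\` E n]. *)
pose h_ n x : \bar R := (q n * \1_(B n) x)%:E.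
pose h x := ereal_sup (range (h_^~ x)).
have h_ge n x : h_ n x <= h x by apply: ereal_sup_ubound; exists n.
have mh : borel_fun setT h.
  have -> : h = (fun x => esups (h_^~ x) 0%N).
    apply/funext => x; rewrite /h /esups /sdrop; congr ereal_sup.
    by apply/seteqP; split => _ [n _ <-]; exists n.
  apply: (@measurable_fun_esups _ (g_sigma_algebraType (@open X)) R setT h_ _ 0%N) => n.
  apply/measurable_EFinP; apply: measurable_funM; first exact: measurable_cst.
  exact: measurable_indic.
have fh x : D x -> f x <= h x.
  move=> Dx; rewrite leNgt; apply/negP => hf.
  have h0 : 0 <= h x by apply: le_trans (h_ge 0%N x); rewrite lee_fin mulr_ge0.
  have [r [hr rf]] : exists r : rat, h x < (ratr r)%:E /\ (ratr r)%:E < f x.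
    have hfin : h x \is a fin_num.
      by rewrite ge0_fin_numE// (lt_le_trans hf)// leey.
    move: hf; rewrite -(fineK hfin); case: (f x) => [y||]//.
      rewrite lte_fin => /rat_in_itvoo[r]; rewrite in_itv/= => /andP[h1 h2].
      by exists r; rewrite !lte_fin.
    move=> _; have /rat_in_itvoo[r] : (fine (h x) < fine (h x) + 1)%R by rewrite ltrDl.
    by rewrite in_itv/= => /andP[h1 h2]; exists r; rewrite lte_fin ltry.
  have qr : q (pickle r) = ratr r.
    rewrite /q pickleK max_r// -lee_fin; exact: (le_trans h0 (ltW hr)).
  have : E (pickle r) x by split => //=; rewrite qr.
  have [_ sub _] := HB (pickle r).
  move=> /sub Bx; have := h_ge (pickle r) x.
  by rewrite /h_ indicE mem_set// mulr1 qr leNgt hr.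
have mB n : mu_set (B n) by exact: borel_mu_set.
have EBfin n : mu (E n) < +oo.
  apply: le_lt_trans Dfin; apply: le_outer_measure; exact: subIsetl.
have null n : muC (B n `\` E n) = 0.
  have [_ sub eqm] := HB n.
  have BE : B n `&` E n = E n by apply/setIidPr.
  have Bfin : muC (B n) < +oo by rewrite (_ : muC (B n) = mu (E n)).
  rewrite (measureD (mB n) (mE n) Bfin) BE.
  apply/eqP; rewrite sube_eq ?add0e; last 2 first.
  - by rewrite ge0_fin_numE//; exact: Bfin.
  - by rewrite fin_num_adde_defr// ge0_fin_numE//; exact: EBfin.
  by apply/eqP.
exists h; split=> //.
  by move=> x; apply: le_trans (h_ge 0%N x); rewrite lee_fin mulr_ge0.
apply: ae_eq_integral => //.
  apply: (@measurable_funS _ _ _ _ setT) => //.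
  exact: borel_mu_fun.
pose N := \bigcup_n (B n `\` E n).
have Nneg : muC.-negligible N.
  by apply: negligible_bigcup => n; apply/negligibleP; [exact: measurableD|exact: null].
case: Nneg => M [mM M0 NM]; exists M; split=> // x /= /not_implyP[Dx nfx].
apply: NM; apply: contrapT => nN; apply: nfx.
apply/eqP; rewrite eq_le; apply/andP; split; last exact: fh.
apply: ge_ereal_sup => _ [n _ <-].
rewrite /h_ indicE; have [Bx|nBx] := pselect (B n x); last first.
  by rewrite memNset// mulr0 f0.
rewrite mem_set// mulr1 leNgt; apply/negP => qf; apply: nN.
exists n => //; split=> // -[_ /=]; by rewrite ltNge (ltW qf).
Qed.

End measure.

(** * The total variation on open sets *)

Section variation.
Context {R : realType} {X : completeMetricType R}.
Variable mu : {outer_measure set X -> \bar R}.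
Hypothesis mu_regular : borel_regular mu.
Implicit Types (A B D U W : set X).

Local Notation muC := (mu : set (caratheodory_type mu) -> \bar R).
Local Notation mu_fun D f := (measurable_fun
  (D : set (caratheodory_type mu)) (f : caratheodory_type mu -> \bar R)).
Local Notation mu_set D := (measurable (D : set (caratheodory_type mu))).

(** Membership in [N11loc] is left out: it follows from these conditions as soon
    as the gradients have finite integrals, see [N11loc_upper_gradient]. *)
Definition relaxation A u (u_ g_ : nat -> X -> \bar R) :=
  L1loc_cvg mu A u_ u /\ forall i, upper_gradient A (u_ i) (g_ i).

Lemma compactly_insideS A B U : A `<=` B -> compactly_inside U A ->
  compactly_inside U B.
Proof. by move=> AB [oU cU UA]; split=> // x /UA /AB. Qed.

Lemma compactly_inside_sub A U : compactly_inside U A -> U `<=` A.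
Proof. by move=> [_ _ UA] x /(@subset_closure _ U) /UA. Qed.

Lemma ug_int_mono A U u g : open A -> open U -> U `<=` A ->
  upper_gradient A u g -> mu_int mu U g <= mu_int mu A g.
Proof.
move=> oA oU UA [g0 mg _]; apply: mu_intS => //; try exact: open_mu_set.
by apply: borel_mu_fun => //; exact: open_borel.
Qed.

Lemma L1locS A U u : U `<=` A -> L1loc mu A u -> L1loc mu U u.
Proof. by move=> UA Au W /(compactly_insideS UA); exact: Au. Qed.

Lemma L1loc_cvgS A U u_ u : U `<=` A -> L1loc_cvg mu A u_ u ->
  L1loc_cvg mu U u_ u.
Proof.
move=> UA [Aui Au Acvg]; split.
- by move=> i; exact: L1locS (Aui i).
- exact: L1locS Au.
- by move=> W /(compactly_insideS UA); exact: Acvg.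
Qed.

Lemma relaxationS A U u u_ g_ : open A -> open U -> U `<=` A ->
  relaxation A u u_ g_ -> relaxation U u u_ g_.
Proof.
move=> oA oU UA [cvgu ug]; split; first exact: L1loc_cvgS cvgu.
by move=> i; exact: upper_gradientS (ug i).
Qed.

Lemma N11loc_upper_gradient A u g : open A -> L1loc mu A u ->
  upper_gradient A u g -> mu_int mu A g < +oo -> N11loc mu A u.
Proof.
move=> oA Lu ug gfin U UA; have [oU _ _] := UA.
have Usub := compactly_inside_sub UA.
have LU := Lu U UA; split; first exact: L1_fun LU.
apply: lte_add_pinfty; first by case/integrableP: LU.
apply: le_lt_trans gfin; apply: le_trans (ug_int_mono oA oU Usub ug).
by apply: ereal_inf_lbound; exists g => //; exact: upper_gradientS ug.
Qed.

Lemma open_variation_le A u u_ g_ (t : \bar R) : open A ->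
  relaxation A u u_ g_ -> (forall i, mu_int mu A (g_ i) <= t) ->
  open_variation mu A u <= t.
Proof.
move=> oA [cvgu ug] gt; have [->|tfin] := eqVneq t +oo; first exact: leey.
apply: (@le_trans _ _ (limn_einf (fun i => mu_int mu A (g_ i)))); last first.
  rewrite limn_einf_lim; apply: lime_le; first exact: is_cvg_einfs.
  apply: nearW => n; apply: le_trans (gt n).
  by apply: ereal_inf_lbound; exists n => /=.
apply: ereal_inf_lbound; exists u_, g_; split=> // i.
apply: (N11loc_upper_gradient oA _ (ug i)); first by case: cvgu.
by apply: le_lt_trans (gt i) _; rewrite ltey.
Qed.

Lemma relaxation_subseq A u u_ g_ (phi : nat -> nat) :
  (forall i, i <= phi i)%N -> relaxation A u u_ g_ ->
  relaxation A u (u_ \o phi) (g_ \o phi).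
Proof.
move=> phi_ge [[Lui Lu cvgu] ug]; split; last by move=> i; exact: ug.
split=> // [i|U UA]; first exact: Lui.
have phi_cvg : phi @ \oo --> \oo.
  apply/cvgnyPge => N; near=> n; apply: leq_trans (phi_ge n); near: n.
  exact: nbhs_infty_ge.
exact: (cvg_comp _ _ phi_cvg (cvgu U UA)).
Unshelve. all: by end_near. Qed.

Lemma open_variation_le_near A u u_ g_ (t : \bar R) : open A ->
  relaxation A u u_ g_ -> (\forall i \near \oo, mu_int mu A (g_ i) <= t) ->
  open_variation mu A u <= t.
Proof.
move=> oA rel [N _ HN].
apply: (@open_variation_le _ _ (u_ \o addn N) (g_ \o addn N)) => //.
  by apply: relaxation_subseq => // i; exact: leq_addl.
by move=> i; apply: HN => /=; exact: leq_addr.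
Qed.

Lemma frequently_subseq (P : nat -> Prop) :
  ~ (\forall i \near \oo, ~ P i) ->
  exists2 phi : nat -> nat, (forall i, i <= phi i)%N & forall i, P (phi i).
Proof.
move=> nP; have /choice[phi Hphi] N : exists n, (N <= n)%N /\ P n.
  apply: contrapT => nex; apply: nP; exists N => // n Nn Pn.
  by apply: nex; exists n.
by exists phi => i; have [] := Hphi i.
Qed.

(** Otherwise a subsequence would show that the variation is at most [s]. *)
Lemma relaxation_near_ge A u u_ g_ (s : \bar R) : open A ->
  relaxation A u u_ g_ -> s < open_variation mu A u ->
  \forall i \near \oo, s <= mu_int mu A (g_ i).
Proof.
move=> oA rel sV; apply: contrapT => nearN.
have [|phi phi_ge phiP] := @frequently_subseq (fun i => mu_int mu A (g_ i) < s).
  by move=> h; apply: nearN; apply: filterS h => i /negP; rewrite -leNgt.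
move: sV; apply/negP; rewrite -leNgt.
apply: (open_variation_le oA (relaxation_subseq phi_ge rel)) => i.
exact/ltW/phiP.
Qed.

Lemma relaxation_exists A u (t : \bar R) : open_variation mu A u < t ->
  exists u_ g_, relaxation A u u_ g_ /\ forall i, mu_int mu A (g_ i) <= t.
Proof.
move=> /ereal_inf_lt[_ [u_ [g_ [_ cvgu ug ->]]] Vt].
have rel : relaxation A u u_ g_ by split.
have [|phi phi_ge phiP] := @frequently_subseq (fun i => mu_int mu A (g_ i) < t).
  move=> [N _ HN]; move: Vt; apply/negP; rewrite -leNgt.
  rewrite limn_einf_lim; apply: lime_ge; first exact: is_cvg_einfs.
  exists N => // n /= Nn; apply: le_ereal_inf_tmp => _ [k /= nk <-].
  by rewrite leNgt; apply/negP/HN; exact: leq_trans nk.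
exists (u_ \o phi), (g_ \o phi); split; first exact: relaxation_subseq.
by move=> i; exact/ltW/phiP.
Qed.

Lemma limn_einf_ge (f : nat -> \bar R) t : (forall n, t <= f n) -> t <= limn_einf f.
Proof.
move=> tf; rewrite limn_einf_lim; apply: lime_ge; first exact: is_cvg_einfs.
by apply: nearW => n; apply: le_ereal_inf_tmp => _ [k _ <-].
Qed.

Lemma open_variation_ge0 A u : 0 <= open_variation mu A u.
Proof.
apply: le_ereal_inf_tmp => _ [u_ [g_ [_ _ ug ->]]].
by apply: limn_einf_ge => n; apply: mu_int_ge0 => x Ax; case: (ug n) => g0 _ _; exact: g0.
Qed.

Lemma open_variation_fin A u : open_variation mu A u < +oo ->
  open_variation mu A u \is a fin_num.
Proof. by rewrite ge0_fin_numE// open_variation_ge0. Qed.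

Lemma relaxation_exists_eps A u (e : R) : (0 < e)%R ->
  open_variation mu A u < +oo ->
  exists u_ g_, relaxation A u u_ g_ /\
    forall i, mu_int mu A (g_ i) <= open_variation mu A u + e%:E.
Proof.
move=> e0 Vfin; apply: relaxation_exists.
by rewrite lteDl ?lte_fin// open_variation_fin.
Qed.

Lemma open_variation_L1loc A u : open_variation mu A u < +oo -> L1loc mu A u.
Proof. by move=> /relaxation_exists[u_ [g_ [[[]]]]]. Qed.

Lemma open_variationS A U u : open A -> open U -> U `<=` A ->
  open_variation mu U u <= open_variation mu A u.
Proof.
move=> oA oU UA; have [->|Vfin] := eqVneq (open_variation mu A u) +oo.
  exact: leey.
apply/lee_addgt0Pr => e e0.
have [|u_ [g_ [rel gle]]] := relaxation_exists_eps (A := A) (u := u) e0.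
  by rewrite ltey.
apply: (open_variation_le oU (relaxationS oA oU UA rel)) => i.
apply: le_trans (gle i); case: rel => _ ug; exact: ug_int_mono (ug i).
Qed.

(** A sequence that is nearly optimal on [W] competes on [A] and on [B]
    simultaneously. *)
Lemma open_variation_disjoint A B W u : open A -> open B -> open W ->
  A `<=` W -> B `<=` W -> A `&` B = set0 ->
  open_variation mu A u + open_variation mu B u <= open_variation mu W u.
Proof.
move=> oA oB oW AW BW AB0.
have [->|Wfin] := eqVneq (open_variation mu W u) +oo; first exact: leey.
have Wlt : open_variation mu W u < +oo by rewrite ltey.
have Afin : open_variation mu A u \is a fin_num.
  by apply: open_variation_fin; apply: le_lt_trans Wlt; exact: open_variationS.
have Bfin : open_variation mu B u \is a fin_num.
  by apply: open_variation_fin; apply: le_lt_trans Wlt; exact: open_variationS.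
apply/lee_addgt0Pr => e e0; have e3 : (0 < e / 3)%R by rewrite divr_gt0.
have [u_ [g_ [rel gle]]] := relaxation_exists_eps e3 Wlt.
have near D : open D -> D `<=` W -> open_variation mu D u \is a fin_num ->
    \forall i \near \oo, open_variation mu D u - (e / 3)%:E <= mu_int mu D (g_ i).
  move=> oD DW Dfin; apply: (relaxation_near_ge oD (relaxationS oW oD DW rel)).
  by rewrite lteBlDr// lteDl// lte_fin.
have [N _ HA] := near A oA AW Afin; have [M _ HB] := near B oB BW Bfin.
have {}HA := HA (N + M)%N (leq_addr _ _); have {}HB := HB (N + M)%N (leq_addl _ _).
have := gle (N + M)%N; case: rel => _ /(_ (N + M)%N)[g0 mg _].
have mA := open_mu_set mu_regular oA; have mB := open_mu_set mu_regular oB.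
have mW := open_mu_set mu_regular oW.
have mgW := borel_mu_fun mu_regular (open_borel oW) mg.
have ABW : A `|` B `<=` W by move=> x [/AW|/BW].
have : mu_int mu A (g_ (N + M)%N) + mu_int mu B (g_ (N + M)%N) <=
    mu_int mu W (g_ (N + M)%N).
  rewrite /mu_int -ge0_integral_setU//.
  - by apply: mu_intS => //; exact: measurableU.
  - exact: (measurable_funS mW ABW mgW).
  - by move=> x /ABW /g0.
  - by apply/disj_setPS; rewrite AB0.
move: HA HB Afin Bfin.
move: (mu_int _ A _) (mu_int _ B _) (mu_int _ W _) => a b c.
move: (open_variation _ A _) (open_variation _ B _) (open_variation _ W _).
move=> [x||]// [y||]// z ax by_ _ _ abc cw.
move: ax by_; rewrite !leeBlDr// => ax by_.
apply: (@le_trans _ _ ((a + (e / 3)%:E) + (b + (e / 3)%:E))); first exact: leeD.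
rewrite addeACA; apply: le_trans (leeD (le_trans abc cw) (lexx _)) _.
by rewrite -addeA leeD2l// -!EFinD lee_fin; lra.
Qed.

Lemma relaxationB A u w u_ w_ gu gw : open A ->
  relaxation A u u_ gu -> relaxation A w w_ gw ->
  relaxation A (fun x => u x - w x) (fun i x => u_ i x - w_ i x)
    (fun i x => gu i x + gw i x).
Proof.
move=> oA [[Lui Lu cvgu] ugu] [[Lwi Lw cvgw] ugw]; split; last first.
  by move=> i; exact: upper_gradientB.
have mA U : compactly_inside U A -> mu_set U by move=> [/(open_mu_set mu_regular)].
split.
- by move=> i U UA; apply: integrableB; [exact: mA|exact: Lui|exact: Lwi].
- by move=> U UA; apply: integrableB; [exact: mA|exact: Lu|exact: Lw].
move=> U UA; have mU := mA U UA.
have m1 i := mu_fun_abs_sub (L1_fun (Lui i U UA)) (L1_fun (Lu U UA)).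
have m2 i := mu_fun_abs_sub (L1_fun (Lwi i U UA)) (L1_fun (Lw U UA)).
apply: (@squeeze_cvge _ _ _ _ (cst 0) _ (fun i =>
  mu_int mu U (fun x => `|u_ i x - u x|) + mu_int mu U (fun x => `|w_ i x - w x|))).
- apply: nearW => i; rewrite mu_int_ge0//=.
  apply: mu_int_dominated => //.
    by apply: mu_fun_abs_sub; apply: emeasurable_funB; apply: L1_fun;
      [exact: Lui|exact: Lwi|exact: Lu|exact: Lw].
  by move=> x _; exact: lee_abs_subB.
- exact: cvg_cst.
- rewrite -[X in _ --> X](adde0 0); apply: cvgeD => //; [exact: cvgu|exact: cvgw].
Qed.

Lemma open_variationB A u w : open A ->
  open_variation mu A u < +oo -> open_variation mu A w < +oo ->
  open_variation mu A (fun x => u x - w x) <=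
  open_variation mu A u + open_variation mu A w.
Proof.
move=> oA ufin wfin; apply/lee_addgt0Pr => e e0.
have e2 : (0 < e / 2)%R by rewrite divr_gt0.
have [u_ [gu [relu ule]]] := relaxation_exists_eps e2 ufin.
have [w_ [gw [relw wle]]] := relaxation_exists_eps e2 wfin.
apply: (open_variation_le oA (relaxationB oA relu relw)) => i.
have [_ /(_ i)[gu0 mgu _]] := relu; have [_ /(_ i)[gw0 mgw _]] := relw.
have bA := open_borel oA.
rewrite mu_intD//; [|exact: open_mu_set|exact: borel_mu_fun|exact: borel_mu_fun].
apply: le_trans (leeD (ule i) (wle i)) _.
by rewrite addeACA -EFinD -splitr.
Qed.

Lemma open_variation_cst A (c : R) : open A -> L1loc mu A (cst c%:E) ->
  open_variation mu A (cst c%:E) = 0.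
Proof.
move=> oA Lc; apply/eqP; rewrite eq_le open_variation_ge0 andbT.
apply: (@open_variation_le _ _ (fun=> cst c%:E) (fun=> cst 0)) => //.
  split; last by move=> _; exact: upper_gradient_cst.
  split=> // U UA; rewrite [X in X @ _](_ : _ = cst 0); first exact: cvg_cst.
  apply/funext => i; rewrite /mu_int; under eq_integral do rewrite /= subrr normr0.
  exact: integral0.
by move=> _; rewrite /mu_int integral0.
Qed.

(** Values may be changed on null sets; this replaces functions with infinite
    values by real-valued ones. *)
Lemma open_variation_ae A u w (N : set X) : open A -> mu N = 0 ->
  (forall x, A x -> ~ N x -> u x = w x) -> L1loc mu A w ->
  open_variation mu A w <= open_variation mu A u.
Proof.
move=> oA N0 uw Lw.
have [->|Vfin] := eqVneq (open_variation mu A u) +oo; first exact: leey.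
apply/lee_addgt0Pr => e e0.
have [|u_ [g_ [[[Lui Lu cvgu] ug] gle]]] := relaxation_exists_eps (A := A) (u := u) e0.
  by rewrite ltey.
apply: (@open_variation_le _ _ u_ g_) => //; split=> //; split=> // U UA.
have mU : mu_set U by case: UA => /(open_mu_set mu_regular).
have UsA := compactly_inside_sub UA.
have nN : muC.-negligible N.
  have [B [bB NB B0]] := mu_regular.2 N.
  by exists B; split=> //; [exact: borel_mu_set|rewrite -N0].
rewrite [X in X @ _ --> _](_ : _ = (fun i => mu_int mu U (fun x => `|u_ i x - u x|))).
  exact: cvgu.
apply/funext => i; apply: ae_eq_integral => //.
- by apply: mu_fun_abs_sub; apply: L1_fun; [exact: Lui|exact: Lw].
- by apply: mu_fun_abs_sub; apply: L1_fun; [exact: Lui|exact: Lu].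
case: nN => M [mM M0 NM]; exists M; split=> // x /= /not_implyP[Ux neq].
by apply: NM; apply: contrapT => Nx; apply: neq; rewrite uw//; exact: UsA.
Qed.

End variation.

(** * Lipschitz functions and compactness *)

Section lipschitz_topology.
Context {R : realType} {X : completeMetricType R}.
Implicit Types (A F K U : set X) (x y : X).

Lemma lipschitz_continuous (f : X -> R) (L : R) : (0 <= L)%R ->
  (forall x y, `|f x - f y| <= L * mdist x y)%R -> continuous f.
Proof.
move=> L0 fL x; apply/cvgrPdist_lt => e e0.
have L1 : (0 < L + 1)%R by rewrite ltr_wpDl.
have : nbhs x (ball x (e / (L + 1))%R) by apply: nbhsx_ballx; rewrite divr_gt0.
apply: filterS => y; rewrite ballEmdist/= ltr_pdivlMr// => xy.
apply: le_lt_trans (fL x y) _; apply: le_lt_trans xy.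
by rewrite mulrC ler_wpM2l ?mdist_ge0// lerDl.
Qed.

Lemma open_lt_fun (f : X -> R) (a : R) : continuous f -> open [set x | (a < f x)%R].
Proof. by move=> cf; apply: (open_comp (f := f) (D := [set r | (a < r)%R])). Qed.

Lemma open_gt_fun (f : X -> R) (a : R) : continuous f -> open [set x | (f x < a)%R].
Proof. by move=> cf; apply: (open_comp (f := f) (D := [set r | (r < a)%R])). Qed.

Lemma closed_le_fun (f : X -> R) (a : R) : continuous f -> closed [set x | (a <= f x)%R].
Proof.
by move=> cf; apply: (preimage_closed (f := f) (D := [set r | (a <= r)%R])).
Qed.

Lemma closed_ge_fun (f : X -> R) (a : R) : continuous f -> closed [set x | (f x <= a)%R].
Proof.
by move=> cf; apply: (preimage_closed (f := f) (D := [set r | (r <= a)%R])).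
Qed.

Lemma metric_ball_open x (r : R) : open (ball x r).
Proof.
rewrite ballEmdist; apply: open_gt_fun; apply: (@lipschitz_continuous _ 1%R) => //.
move=> y z; rewrite mul1r ler_norml.
have := metric_triangle x z y; have := metric_triangle x y z.
by rewrite (metric_sym z y) => *; apply/andP; split; lra.
Qed.

(** The distance to a set, truncated at [1] so as to make sense also for the
    empty set. *)
Definition capdist F x : R :=
  inf [set r | r = 1%R \/ exists2 y, F y & r = mdist x y].

Let capdist_lbound F x :
  lbound [set r | r = 1%R \/ exists2 y, F y & r = mdist x y] 0%R.
Proof. by move=> r [->|[y _ ->]]; rewrite ?ler01 ?mdist_ge0. Qed.

Lemma capdist_ge0 F x : (0 <= capdist F x)%R.
Proof.
by apply: lb_le_inf; [exists 1%R; left|exact: capdist_lbound].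
Qed.

Lemma capdist0 F x : F x -> capdist F x = 0%R.
Proof.
move=> Fx; apply/eqP; rewrite eq_le capdist_ge0 andbT.
apply: ge_inf; first by exists 0%R; exact: capdist_lbound.
by right; exists x => //; rewrite mdistxx.
Qed.

Lemma capdist_lipschitz F x y : (`|capdist F x - capdist F y| <= mdist x y)%R.
Proof.
have H z t : (capdist F z <= mdist z t + capdist F t)%R.
  rewrite -lerBlDl; apply: lb_le_inf; first by exists 1%R; left.
  move=> r [->|[w Fw ->]].
    rewrite lerBlDl; apply: (@le_trans _ _ 1%R); last by rewrite lerDr mdist_ge0.
    by apply: ge_inf; [exists 0%R; exact: capdist_lbound|left].
  rewrite lerBlDl; apply: (@le_trans _ _ (mdist z w)); last exact: metric_triangle.
  by apply: ge_inf; [exists 0%R; exact: capdist_lbound|right; exists w].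
rewrite ler_norml lerBlDr (H x y) andbT lerNl opprB lerBlDr.
by rewrite metric_sym H.
Qed.

Lemma capdist_continuous F : continuous (capdist F).
Proof.
apply: (@lipschitz_continuous _ 1%R) => // x y.
by rewrite mul1r capdist_lipschitz.
Qed.

Lemma capdist_gt0 U x : open U -> U x -> (0 < capdist (~` U) x)%R.
Proof.
move=> oU Ux; have /nbhs_ballP[e /= e0 He] : nbhs x U by exact: open_nbhs_nbhs.
apply: (@lt_le_trans _ _ (Num.min 1%R e)); first by rewrite lt_min ltr01.
apply: lb_le_inf; first by exists 1%R; left.
move=> r [->|[y nUy ->]]; first by rewrite ge_min lexx.
rewrite ge_min; apply/orP; right; rewrite leNgt; apply/negP => xy; apply: nUy.
by apply: He; rewrite ballEmdist.
Qed.

Lemma capdist_in U x : (0 < capdist (~` U) x)%R -> U x.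
Proof.
by move=> cx; apply: contrapT => nUx; move: cx; rewrite capdist0// ltxx.
Qed.

Lemma compact_lower_bound K (f : X -> R) : compact K -> continuous f ->
  (forall x, K x -> 0 < f x)%R ->
  \forall n \near \oo, K `<=` [set x | (n.+1%:R^-1 < f x)%R].
Proof.
move=> cK cf f0.
move/compact_near_coveringP : cK.
apply => x Kx.
have fx0 := f0 x Kx; have fx2 : (0 < f x / 2)%R by rewrite divr_gt0.
exists ([set y | (f x / 2 < f y)%R], [set n | (n.+1%:R^-1 < f x / 2)%R]); last first.
  by move=> [y n] /= [h1 h2]; exact: lt_trans h1.
split=> /=.
  apply: open_nbhs_nbhs; split; first exact: open_lt_fun.
  by rewrite /= ltr_pdivrMr// mulr2n mulrDr mulr1 ltrDl.
exact: near_infty_natSinv_lt (PosNum fx2).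
Qed.

Lemma compact_sub_ball K x0 : compact K -> exists2 M : R, (0 < M)%R & K `<=` ball x0 M.
Proof.
move=> cK; move/compact_near_coveringP : cK => /(_ nat \oo (fun n => ball x0 n.+1%:R)).
case=> [x Kx|N _ HN]; last first.
  by exists N.+1%:R => //; exact: (HN N (leqnn N)).
pose m := Num.truncn (mdist x0 x + 1)%R.
exists (ball x 1%R, [set n | (m <= n)%N]).
  by split => /=; [exact: nbhsx_ballx|exact: nbhs_infty_ge].
move=> [y n] /= [xy mn]; move: xy; rewrite !ballEmdist/= => xy.
apply: le_lt_trans (metric_triangle x0 x y) _.
apply: (@lt_trans _ _ (mdist x0 x + 1)%R); first by rewrite ltrD2l.
by apply: lt_le_trans (truncnS_gt _) _; rewrite ler_nat ltnS.
Qed.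

Definition totally_bounded A := forall e : R, (0 < e)%R ->
  exists s : seq X, forall x, A x -> exists2 y, y \in s & ball y e x.

Lemma ultra_seq_cover (G : set_system X) (s : seq X) (B : X -> set X) :
  UltraFilter G -> G [set x | exists2 y, y \in s & B y x] ->
  exists2 y, y \in s & G (B y).
Proof.
move=> uG; elim: s => [|y s ih] Gs.
  exfalso; apply: (@filter_not_empty _ G _).
  by apply: filterS Gs => x [].
have [Gy|Gny] := in_ultra_setVsetC (B y) uG; first by exists y; rewrite ?mem_head.
have [|z zs Gz] := ih; last by exists z => //; rewrite inE zs orbT.
apply: filterS (filterI Gs Gny) => x [[z]].
by rewrite inE => /orP[/eqP ->//|zs Bz _]; exists z.
Qed.

(** An ultrafilter containing a totally bounded set is Cauchy, hence convergent
    by completeness. *)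
Lemma totally_bounded_compact A : closed A -> totally_bounded A -> compact A.
Proof.
move=> cA tA; rewrite compact_ultra => G uG GA.
have cG : cauchy G.
  apply: cauchy_exP => e e0; have [s Hs] := tA e e0.
  have [|y _ Gy] := @ultra_seq_cover G s (fun y => ball y e) uG.
    by apply: filterS GA => x /Hs.
  by exists y.
have cvgG : cvg G by exact: cauchy_cvg.
exists (lim G); split=> //; rewrite (closure_id A).1// => B nB.
exact: (filter_ex (filterI GA (cvgG B nB))).
Qed.

End lipschitz_topology.

Section doubling_topology.
Context {R : realType} {X : completeMetricType R}.
Variable mu : {outer_measure set X -> \bar R}.
Hypothesis mu_regular : borel_regular mu.
Hypothesis mu_doubling : doubling mu.
Implicit Types (A F K U : set X) (x y : X).

Lemma ball_finite x r : mu (ball x r) < +oo.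
Proof.
have [c c0 Hc] := mu_doubling.
have M0 : (0 < `|r| + 1)%R by rewrite ltr_wpDl.
have [_ h1 h2] := Hc x _ M0; apply: le_lt_trans h2; apply: le_trans h1.
apply: le_outer_measure; rewrite !ballEmdist => y /= xy.
by apply: lt_le_trans xy _; have := ler_norm r; lra.
Qed.

Lemma compact_finite_measure K : compact K -> mu K < +oo.
Proof.
move=> cK; have [M _ KM] := compact_sub_ball (point : X) cK.
exact: le_lt_trans (le_outer_measure mu _ _ KM) (ball_finite _ _).
Qed.

(** Iterating the doubling condition, all balls of a given radius centred in a
    bounded set have measure bounded below. *)
Lemma ball_measure_lower_bound x0 (M r : R) : (0 < M)%R -> (0 < r)%R ->
  exists2 m : R, (0 < m)%R & forall y, ball x0 M y -> m%:E <= mu (ball y r).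
Proof.
move=> M0 r0; have [c c0 Hc] := mu_doubling.
have iter n y : mu (ball y (2 ^+ n * r)%R) <= (c ^+ n)%:E * mu (ball y r).
  elim: n => [|n ih]; first by rewrite !expr0 mul1r mul1e.
  rewrite exprS -mulrA; have [|_ h _] := Hc y (2 ^+ n * r)%R.
    by rewrite mulr_gt0// exprn_gt0.
  apply: le_trans h _; rewrite exprS EFinM -muleA.
  by apply: lee_wpmul2l => //; rewrite lee_fin ltW.
pose k := Num.truncn (2 * M / r)%R.
have kM : (2 * M <= 2 ^+ k.+1 * r)%R.
  rewrite -ler_pdivrMr//; apply/ltW/(lt_le_trans (truncnS_gt _)).
  by rewrite -natrX ler_nat ltnW// ltn_expl.
have Mfin : mu (ball x0 M) \is a fin_num by rewrite ge0_fin_numE ?ball_finite.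
have Mpos : (0 < fine (mu (ball x0 M)))%R.
  apply: fine_gt0; rewrite ball_finite andbT.
  have M2 : (0 < M / 2)%R by rewrite divr_gt0.
  have [+ _ _] := Hc x0 _ M2.
  by rewrite mulrCA divff// mulr1.
exists (fine (mu (ball x0 M)) / c ^+ k.+1)%R; first by rewrite divr_gt0// exprn_gt0.
move=> y yM; have ck : (0 < c ^+ k.+1)%R by exact: exprn_gt0.
rewrite -(@lee_pmul2l _ (c ^+ k.+1)%:E)// ?lte_fin//.
apply: le_trans (iter k.+1 y).
rewrite -EFinM mulrCA divff ?gt_eqF// mulr1 fineK//.
apply: le_outer_measure; move: yM; rewrite !ballEmdist => /= yM z /= xz.
apply: le_lt_trans (metric_triangle y x0 z) _; apply: lt_le_trans kM.
by rewrite metric_sym mulr_natl mulr2n ltrD.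
Qed.

(** Balls of radius [e / 2] centred at an [e]-separated sequence are disjoint, and
    their measures are bounded below: a bounded set, having finite measure,
    contains no such sequence. *)
Lemma ball_totally_bounded x0 (M : R) : (0 < M)%R -> totally_bounded (ball x0 M).
Proof.
move=> M0 e e0; apply: contrapT => nex.
have /choice[f Hf] : forall s : seq X, exists x, ball x0 M x /\
    forall y, y \in s -> ~ ball y e x.
  move=> s; apply: contrapT => nx; apply: nex; exists s => x Mx.
  apply: contrapT => ny; apply: nx; exists x; split=> // y ys yx.
  by apply: ny; exists y.
pose S := fix S n := if n is n'.+1 then f (S n') :: S n' else [::].
pose y n := f (S n).
have yS m n : (m < n)%N -> y m \in S n.
  elim: n => // n ih; rewrite ltnS leq_eqVlt => /orP[/eqP ->|/ih mn].
    exact: mem_head.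
  by rewrite /= inE mn orbT.
have sep m n : (m < n)%N -> (e <= mdist (y m) (y n))%R.
  move=> mn; rewrite leNgt; apply/negP => h.
  have [_ /(_ _ (yS m n mn))] := Hf (S n); apply.
  by rewrite ballEmdist.
have e2 : (0 < e / 2)%R by rewrite divr_gt0.
pose B n := ball (y n) (e / 2)%R.
have trivB : trivIset setT B.
  have sep' m n : (m < n)%N -> B m `&` B n !=set0 -> False.
    move=> mn [z []]; rewrite /B !ballEmdist/= => h1 h2.
    have := sep m n mn; apply/negP; rewrite -ltNge.
    apply: le_lt_trans (metric_triangle (y m) z (y n)) _.
    by rewrite (splitr e) ltrD// metric_sym.
  move=> m n _ _ mn; apply/eqP/negPn/negP => /eqP neq.
  case: (ltngtP m n) neq => // [h _|h _].
  - exact: (sep' _ _ h mn).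
  - by rewrite setIC in mn; exact: (sep' _ _ h mn).
have mB n : mu.-caratheodory (B n).
  apply: (open_mu_set mu_regular); exact: metric_ball_open.
have [m m0 Hm] := ball_measure_lower_bound x0 M0 e2.
pose W : set X := ball x0 (M + e / 2)%R.
have BW n : B n `<=` W.
  have [+ _] := Hf (S n); rewrite /B /W -/(y n) !ballEmdist => /= h z /= h2.
  by apply: le_lt_trans (metric_triangle _ (y n) _) (ltrD h h2).
have bound n : (n%:R * m)%:E <= mu W.
  apply: (@le_trans _ _ (mu (W `&` \big[setU/set0]_(i < n) B i))); last first.
    by apply: le_outer_measure => z [].
  rewrite caratheodory_additive//.
  have -> : (n%:R * m)%:E = \sum_(i < n) m%:E.
    by rewrite sumEFin big_const iter_addr card_ord addr0 mulr_natl.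
  apply: lee_sum => i _; have -> : W `&` B i = B i.
    by apply/seteqP; split=> [z []//|z Bz]; split=> //; exact: BW Bz.
  apply: Hm.
  by have [] := Hf (S i).
have Wfin : mu W \is a fin_num by rewrite ge0_fin_numE ?ball_finite.
pose n := (Num.truncn (fine (mu W) / m)).+1.
have := bound n; rewrite -(fineK Wfin) lee_fin -ler_pdivlMr// leNgt.
by rewrite truncnS_gt.
Qed.

Lemma closure_ball_compact x0 (M : R) : (0 < M)%R -> compact (closure (ball x0 M)).
Proof.
move=> M0; apply: totally_bounded_compact; first exact: closed_closure.
move=> e e0; have M1 : (0 < M + 1)%R by rewrite ltr_wpDr.
have [s Hs] := @ball_totally_bounded x0 _ M1 e e0.
exists s => x cx; apply: Hs.
have [z [+ +]] := cx _ (nbhsx_ballx x 1%R ltr01).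
rewrite !ballEmdist/= => h1 h2.
apply: le_lt_trans (metric_triangle _ z _) _; rewrite ltrD//.
by rewrite metric_sym.
Qed.

Lemma compactly_inside_finite U V : compactly_inside U V -> mu U < +oo.
Proof.
move=> [_ cU _]; apply: le_lt_trans (compact_finite_measure cU).
exact/le_outer_measure/subset_closure.
Qed.

Lemma compact_neighborhood K U : compact K -> open U -> K `<=` U ->
  exists V, K `<=` V /\ compactly_inside V U.
Proof.
move=> cK oU KU.
pose f := capdist (~` U); have cf : continuous f by exact: capdist_continuous.
have [n _ /(_ n (leqnn n)) Kn] := compact_lower_bound cK cf
  (fun x Kx => capdist_gt0 oU (KU x Kx)).
have [M M0 KM] := compact_sub_ball (point : X) cK.
exists ([set x | (n.+1%:R^-1 < f x)%R] `&` ball (point : X) M); split.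
  by move=> x Kx; split; [exact: Kn|exact: KM].
have sub1 : closure ([set x | (n.+1%:R^-1 < f x)%R] `&` ball (point : X) M)
   `<=` [set x | (n.+1%:R^-1 <= f x)%R].
  rewrite [X in _ `<=` X](closure_id _).1; last exact: closed_le_fun.
  by apply: closure_subset => x [/= /ltW].
split.
- by apply: openI; [exact: open_lt_fun|exact: metric_ball_open].
- apply: (@subclosed_compact _ _ (closure (ball (point : X) M))).
  + exact: closed_closure.
  + exact: closure_ball_compact.
  + by apply: closure_subset => x [].
- by move=> x /sub1 /= fx; apply: capdist_in; exact: lt_le_trans fx.
Qed.

(** Between the levels [a] and [6 * a] there is room for a cutoff varying in
    [3 * a <= rho <= 4 * a] and for the larger layer [2 * a < rho < 5 * a]. *)
Lemma cutoff_level K U : compact K -> open U -> K `<=` U ->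
  exists (rho : X -> R) (a : R), [/\ (0 < a)%R,
    forall x y, (`|rho x - rho y| <= mdist x y)%R,
    compact [set x | (a <= rho x)%R], [set x | (a <= rho x)%R] `<=` U &
    forall x, K x -> (6 * a < rho x)%R].
Proof.
move=> cK oU KU; have [V [KV [oV cV VU]]] := compact_neighborhood cK oU KU.
pose f := capdist (~` V); have cf : continuous f by exact: capdist_continuous.
have [n _ /(_ n (leqnn n)) Kn] := compact_lower_bound cK cf
  (fun x Kx => capdist_gt0 oV (KV x Kx)).
pose a : R := (n.+1%:R^-1 / 6)%R.
have a0 : (0 < a)%R by rewrite divr_gt0.
have aV : [set x | (a <= f x)%R] `<=` V.
  by move=> x /= fx; apply: capdist_in; exact: lt_le_trans fx.
exists f, a; split=> //.
- exact: capdist_lipschitz.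
- apply: (subclosed_compact _ cV); first exact: closed_le_fun.
  by move=> x /aV; exact: subset_closure.
- by move=> x /aV/(@subset_closure _ V)/VU.
- by move=> x /Kn /=; rewrite /a mulrC divfK.
Qed.

Lemma exhaustion A : open A -> compact (closure A) ->
  exists A_ : nat -> set X, (forall n, compactly_inside (A_ n) A) /\
    forall U, compactly_inside U A -> \forall n \near \oo, U `<=` A_ n.
Proof.
move=> oA cA; pose f := capdist (~` A).
have cf : continuous f by exact: capdist_continuous.
exists (fun n => [set x | (n.+1%:R^-1 < f x)%R]); split; last first.
  move=> U [oU cU UA].
  have := compact_lower_bound cU cf (fun x Ux => capdist_gt0 oA (UA x Ux)).
  by apply: filterS => n Hn x /(@subset_closure _ U)/Hn.
move=> n; have sub1 : closure [set x | (n.+1%:R^-1 < f x)%R]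
   `<=` [set x | (n.+1%:R^-1 <= f x)%R].
  rewrite [X in _ `<=` X](closure_id _).1; last exact: closed_le_fun.
  by apply: closure_subset => x /= /ltW.
have subA : closure [set x | (n.+1%:R^-1 < f x)%R] `<=` A.
  by move=> x /sub1 /= fx; apply: capdist_in; exact: lt_le_trans fx.
split=> //; first exact: open_lt_fun.
apply: (subclosed_compact _ cA); first exact: closed_closure.
by move=> x /subA; exact: subset_closure.
Qed.

Lemma separable_bounded x0 (M : R) : (0 < M)%R ->
  exists2 D : set X, countable D &
    forall x (e : R), (0 < e)%R -> ball x0 M x -> exists2 y, D y & ball x e y.
Proof.
move=> M0; have /choice[s Hs] n : exists s : seq X, forall x, ball x0 M x ->
    exists2 y, y \in s & ball y (n.+1%:R^-1 : R)%R x.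
  exact: (ball_totally_bounded x0 M0).
exists (\bigcup_n [set` s n]).
  by apply: bigcup_countable => // n _; exact: finite_set_countable.
move=> x e e0 Mx.
have [N _ /(_ N (leqnn N)) HN] := near_infty_natSinv_lt (PosNum e0).
have [y ys yx] := Hs N x Mx; exists y; first by exists N.
by apply: ball_sym; apply: le_ball yx; exact: ltW.
Qed.

End doubling_topology.

(** * Lower semicontinuity and gluing of the total variation *)

Lemma cvge0_near_le (R : realType) (f : nat -> \bar R) (e : R) :
  f @ \oo --> 0 -> (0 < e)%R -> \forall n \near \oo, f n <= e%:E.
Proof.
move=> f0 e0; have : nbhs (0 : \bar R) [set x | x < e%:E].
  by apply: open_nbhs_nbhs; split; [exact: open_ereal_lt_ereal|rewrite /= lte_fin].
move=> /f0 H; near=> n; apply: ltW; near: n; exact: H.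
Unshelve. all: by end_near.
Qed.

Lemma abse_subC (R : realDomainType) (x y : \bar R) : `|x - y| = `|y - x|.
Proof. by move: x y => [x||] [y||] //=; rewrite distrC. Qed.

Lemma squeeze_cvge0 (R : realType) (f g : nat -> \bar R) :
  (\forall n \near \oo, 0 <= f n <= g n) -> g @ \oo --> 0 -> f @ \oo --> 0.
Proof.
by move=> fg g0; apply: (@squeeze_cvge _ _ _ _ (cst 0) _ g) => //; exact: cvg_cst.
Qed.

Section variation_limits.
Context {R : realType} {X : completeMetricType R}.
Variable mu : {outer_measure set X -> \bar R}.
Hypothesis mu_regular : borel_regular mu.
Implicit Types (A B D U W : set X).

Local Notation muC := (mu : set (caratheodory_type mu) -> \bar R).
Local Notation mu_fun D f := (measurable_fun
  (D : set (caratheodory_type mu)) (f : caratheodory_type mu -> \bar R)).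
Local Notation mu_set D := (measurable (D : set (caratheodory_type mu))).

Lemma L1_L1loc A u : open A -> L1 mu A u -> L1loc mu A u.
Proof.
move=> oA Lu U UA; apply: (L1S mu_regular oA) Lu; first by case: UA.
exact: compactly_inside_sub.
Qed.

Lemma mu_int_triangle D f g h : mu_set D -> mu_fun D f -> mu_fun D g ->
  mu_fun D h -> mu_int mu D (fun x => `|f x - h x|) <=
    mu_int mu D (fun x => `|f x - g x|) + mu_int mu D (fun x => `|g x - h x|).
Proof.
move=> mD mf mg mh; apply: mu_int_dominated => //.
- exact: mu_fun_abs_sub.
- exact: mu_fun_abs_sub.
- exact: mu_fun_abs_sub.
- by move=> x _; exact: lee_abs_subD.
Qed.

(** Diagonal argument: a term close to [u_ k] on the [n]-th set of an exhaustion
    of [A], for a [k] such that [u_ k] is close to [u], is close to [u] there. *)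
Lemma lower_semicontinuity A u (u_ : nat -> X -> \bar R) (t : \bar R) :
  doubling mu -> open A -> compact (closure A) ->
  (forall k, L1 mu A (u_ k)) -> L1 mu A u ->
  mu_int mu A (fun x => `|u_ k x - u x|) @[k --> \oo] --> 0 ->
  (\forall k \near \oo, open_variation mu A (u_ k) <= t) ->
  open_variation mu A u <= t.
Proof.
move=> mu_doubling oA cA Luk Lu cvgu Vt.
have [->|tfin] := eqVneq t +oo; first exact: leey.
apply/lee_addgt0Pr => e e0.
have [A_ [A_in A_exh]] := exhaustion oA cA.
pose d n : R := (n.+1%:R^-1 / 2)%R.
have d0 n : (0 < d n)%R by rewrite divr_gt0.
have mA := open_mu_set mu_regular oA.
have mf k := L1_fun (Luk k); have mu_ := L1_fun Lu.
have /choice[p Hp] n : exists p : (X -> \bar R) * (X -> \bar R),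
    [/\ L1loc mu A p.1, upper_gradient A p.1 p.2, mu_int mu A p.2 <= t + e%:E &
     mu_int mu (A_ n) (fun x => `|p.1 x - u x|) <= (n.+1%:R^-1)%:E].
  have [k [Vk uk]] := filter_ex (filterI Vt (cvge0_near_le cvgu (d0 n))).
  have Vkt : open_variation mu A (u_ k) < t + e%:E.
    have tf : t \is a fin_num.
      by rewrite ge0_fin_numE ?ltey// (le_trans (open_variation_ge0 mu A (u_ k))).
    by apply: le_lt_trans Vk _; rewrite lteDl.
  have [v_ [g_ [[[Lv _ cvgv] ug] gt]]] := relaxation_exists Vkt.
  have [i vi] := filter_ex (cvge0_near_le (cvgv _ (A_in n)) (d0 n)).
  exists (v_ i, g_ i); split; [exact: Lv|exact: ug|exact: gt|].
  have oAn : open (A_ n) by case: (A_in n).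
  have AnA := compactly_inside_sub (A_in n).
  have mAn := open_mu_set mu_regular oAn.
  apply: le_trans (mu_int_triangle mAn (L1_fun (Lv i _ (A_in n)))
    (measurable_funS mA AnA (mf k)) (measurable_funS mA AnA mu_)) _.
  rewrite [X in _ <= X%:E](splitr _) EFinD; apply: leeD => //.
  apply: le_trans uk; apply: mu_intS => //.
  exact: mu_fun_abs_sub.
apply: (@open_variation_le _ _ _ mu_regular A u (fun n => (p n).1) (fun n => (p n).2)) => //.
  split; last by move=> n; case: (Hp n).
  split; first by move=> n; case: (Hp n).
    exact: L1_L1loc.
  move=> U UA; have oU : open U by case: UA.
  have UsA := compactly_inside_sub UA.
  apply: (@squeeze_cvge0 _ _ (fun n => (n.+1%:R^-1)%:E)); last first.
    by apply: cvg_EFin; [exact: nearW|exact: cvg_harmonic].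
  apply: filterS (A_exh U UA) => n Un; rewrite mu_int_ge0//=.
  have [Lp _ _ ple] := Hp n; apply: le_trans ple.
  have oAn : open (A_ n) by case: (A_in n).
  apply: mu_intS => //; try exact: open_mu_set.
  apply: mu_fun_abs_sub; first exact: L1_fun (Lp _ (A_in n)).
  exact: (measurable_funS mA (compactly_inside_sub (A_in n)) mu_).
by move=> n; case: (Hp n).
Qed.

Lemma continuous_mu_fun (f : X -> R) D : continuous f -> mu_set D ->
  measurable_fun (D : set (caratheodory_type mu)) (EFin \o f).
Proof.
move=> cf mD; apply/measurable_EFinP.
apply: (@measurable_funS _ _ _ _ setT) => //.
apply: (measurability (@RGenOInfty.G R)) => [|_ [_ [r ->] <-]].
  exact: RGenOInfty.measurableE.
rewrite setTI; apply: (open_mu_set mu_regular).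
have -> : f @^-1` `]r, +oo[ = [set x | (r < f x)%R].
  by apply/seteqP; split => x /=; rewrite in_itv/= andbT.
exact: open_lt_fun.
Qed.

Section glue_variation.
Variables (A B A' B' : set X) (eta : X -> R) (L : R).
Hypotheses (oA : open A) (oB : open B) (oA' : open A') (oB' : open B').
Hypotheses (AA' : A `<=` A') (BB' : B `<=` B').
Hypothesis ABin : compactly_inside (A `&` B) (A' `&` B').
Hypothesis ABfin : mu (A `&` B) < +oo.
Hypothesis L0 : (0 <= L)%R.
Hypothesis eta01 : forall x, (0 <= eta x <= 1)%R.
Hypothesis etaL : forall x y, (`|eta x - eta y| <= L * mdist x y)%R.
Hypothesis eta1 : forall x, A x -> ~ B x -> \forall y \near x, eta y = 1%R.
Hypothesis eta0 : forall x, B x -> ~ A x -> \forall y \near x, eta y = 0%R.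

Let ceta : continuous eta. Proof. exact: lipschitz_continuous etaL. Qed.

(** On [A `|` B] the closure of [{eta != 0}] stays inside [A]. *)
Let support_A U : compactly_inside U (A `|` B) ->
  compactly_inside (U `&` [set x | (0 < eta x)%R]) A'.
Proof.
move=> [oU cU UAB].
have sub : closure (U `&` [set x | (0 < eta x)%R]) `<=` A.
  move=> x cx; have [//|nAx] := pselect (A x).
  have Ux : closure U x by apply: closure_subset cx => y [].
  have Bx : B x by case: (UAB x Ux).
  by have [y [[_ /= + ey]]] := cx _ (eta0 Bx nAx); rewrite ey ltxx.
split; first by apply: openI => //; exact: open_lt_fun.
  apply: (@subclosed_compact _ _ (closure U)) => //; first exact: closed_closure.
  by apply: closure_subset => y [].
by move=> x /sub /AA'.
Qed.

Let support_B U : compactly_inside U (A `|` B) ->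
  compactly_inside (U `&` [set x | (eta x < 1)%R]) B'.
Proof.
move=> [oU cU UAB].
have sub : closure (U `&` [set x | (eta x < 1)%R]) `<=` B.
  move=> x cx; have [//|nBx] := pselect (B x).
  have Ux : closure U x by apply: closure_subset cx => y [].
  have Ax : A x by case: (UAB x Ux).
  by have [y [[_ /= + ey]]] := cx _ (eta1 Ax nBx); rewrite ey ltxx.
split; first by apply: openI => //; exact: open_gt_fun.
  apply: (@subclosed_compact _ _ (closure U)) => //; first exact: closed_closure.
  by apply: closure_subset => y [].
by move=> x /sub /BB'.
Qed.

Let F v w x := (eta x)%:E * v x + (1 - eta x)%:E * w x.

Let meta D : mu_set D ->
  measurable_fun (D : set (caratheodory_type mu)) (EFin \o eta).
Proof. by move=> mD; apply: continuous_mu_fun. Qed.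

Lemma glue_L1loc v w : L1loc mu A' v -> L1loc mu B' w ->
  L1loc mu (A `|` B) (F v w).
Proof.
move=> Lv Lw U UAB; have oU : open U by case: UAB.
have mU := open_mu_set mu_regular oU.
have Lv1 := Lv _ (support_A UAB); have Lw1 := Lw _ (support_B UAB).
set U1 := U `&` _ in Lv1; set U2 := U `&` _ in Lw1.
have mU1 : mu_set U1.
  by apply: (open_mu_set mu_regular); apply: openI => //; exact: open_lt_fun.
have mU2 : mu_set U2.
  by apply: (open_mu_set mu_regular); apply: openI => //; exact: open_gt_fun.
have Lv2 : L1 mu U (v \_ U1).
  move: Lv1; rewrite /L1 (integrable_mkcond _ mU1); exact: integrableS.
have Lw2 : L1 mu U (w \_ U2).
  move: Lw1; rewrite /L1 (integrable_mkcond _ mU2); exact: integrableS.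
have scale (f : X -> \bar R) (e : X -> R) : L1 mu U f ->
    measurable_fun (U : set (caratheodory_type mu)) (EFin \o e) ->
    (forall x, 0 <= e x <= 1)%R -> L1 mu U (fun x => (e x)%:E * f x).
  move=> Lf me e01; apply: (le_integrable mU _ _ Lf).
    by apply: emeasurable_funM; [exact: me|exact: L1_fun Lf].
  move=> x _; have /andP[e0 e1] := e01 x.
  rewrite abseM abse_EFin ger0_norm//.
  by apply: gee_pMl => //; rewrite ?lee_fin.
have e01' x : (0 <= 1 - eta x <= 1)%R by have := eta01 x; lra.
have me : measurable_fun (U : set (caratheodory_type mu)) (EFin \o (fun x => 1 - eta x)%R).
  apply/measurable_EFinP; apply: measurable_funB; first exact: measurable_cst.
  exact/measurable_EFinP/meta.
have := integrableD mU (scale _ _ Lv2 (meta mU) eta01) (scale _ _ Lw2 me e01').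
apply: eq_integrable => // x; rewrite inE => Ux.
have /andP[e0 e1] := eta01 x; rewrite /F /=; congr (_ + _); rewrite patchE.
  case: ifPn => //; rewrite notin_setE /U1 => nU1.
  have -> : eta x = 0%R.
    by apply/eqP; rewrite eq_le e0 andbT leNgt; apply/negP => h; exact: nU1.
  by rewrite !mul0e.
case: ifPn => //; rewrite notin_setE /U2 => nU2.
have -> : eta x = 1%R.
  by apply/eqP; rewrite eq_le e1/= leNgt; apply/negP => h; exact: nU2.
by rewrite subrr !mul0e.
Qed.

Lemma glue_L1loc_cvg v w v_ w_ : L1loc_cvg mu A' v_ v -> L1loc_cvg mu B' w_ w ->
  L1loc_cvg mu (A `|` B) (fun i => F (v_ i) (w_ i)) (F v w).
Proof.
move=> [Lvi Lv cvgv] [Lwi Lw cvgw]; split.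
- by move=> i; exact: glue_L1loc.
- exact: glue_L1loc.
move=> U UAB; have oU : open U by case: UAB.
have mU := open_mu_set mu_regular oU.
have inA := support_A UAB; have inB := support_B UAB.
apply: squeeze_cvge0; last first.
  rewrite -[X in _ --> X](adde0 0); apply: cvgeD => //; [exact: cvgv inA|exact: cvgw inB].
set U1 := U `&` _ in inA *; set U2 := U `&` _ in inB *.
have mU1 : mu_set U1.
  by apply: (open_mu_set mu_regular); apply: openI => //; exact: open_lt_fun.
have mU2 : mu_set U2.
  by apply: (open_mu_set mu_regular); apply: openI => //; exact: open_gt_fun.
apply: nearW => i; rewrite mu_int_ge0//=.
have m1 := mu_fun_abs_sub (L1_fun (Lvi i _ inA)) (L1_fun (Lv _ inA)).
have m2 := mu_fun_abs_sub (L1_fun (Lwi i _ inB)) (L1_fun (Lw _ inB)).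
have restr (S : set X) f : mu_set S -> S `<=` U ->
    mu_int mu S f = mu_int mu U (f \_ S).
  by move=> mS SU; rewrite /mu_int -integral_mkcondr; congr integral;
    apply/seteqP; split => [x Sx|x []//]; split => //; exact: SU.
have mrestr (S : set X) f : mu_set S -> S `<=` U -> mu_fun S f -> mu_fun U (f \_ S).
  move=> mS SU mf; apply/(measurable_restrict _ mS mU).
  by apply: measurable_funS mf => //; exact: subIsetr.
rewrite (restr U1)//; last exact: subIsetl.
rewrite (restr U2)//; last exact: subIsetl.
apply: mu_int_dominated => //.
- apply: mu_fun_abs_sub; apply: L1_fun.
    exact: (glue_L1loc (Lvi i) (Lwi i)).
  exact: (glue_L1loc Lv Lw).
- by apply: mrestr => //; exact: subIsetl.
- by apply: mrestr => //; exact: subIsetl.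
- by move=> x _; apply: erestrict_ge0.
- by move=> x _; apply: erestrict_ge0.
move=> x Ux; have /andP[e0 e1] := eta01 x; rewrite !patchE.
case: ifPn; rewrite ?notin_setE ?inE => xU1; last first.
  have ex : eta x = 0%R.
    by apply/eqP; rewrite eq_le e0 andbT leNgt; apply/negP => h; exact: xU1.
  rewrite /F ex !mul0e !add0e subr0 !mul1e; case: ifPn => //.
  rewrite notin_setE => xU2; exfalso; apply: xU2; split=> //=.
  by rewrite ex ltr01.
case: ifPn; rewrite ?notin_setE ?inE => xU2; first exact: lee_abs_convex.
have ex : eta x = 1%R.
  by apply/eqP; rewrite eq_le e1/= leNgt; apply/negP => h; apply: xU2.
by rewrite /F ex subrr !mul0e !adde0 !mul1e.
Qed.

(** Leibniz rule. The transition set [A `&` B] lies compactly in both [A'] and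
    [B'], so that the mixed term converges along approximations of [v] on [A']
    and of [w] on [B']. *)
Lemma open_variation_glue v w :
  open_variation mu A' v < +oo -> open_variation mu B' w < +oo ->
  open_variation mu (A `|` B) (F v w) <=
  open_variation mu A' v + open_variation mu B' w +
    L%:E * mu_int mu (A `&` B) (fun x => `|v x - w x|).
Proof.
move=> Vv Vw; apply/lee_addgt0Pr => e e0.
(* the error [d] is made four times: in both energies, and in the distances of
   [v_ i] to [v] and of [w_ i] to [w], the latter two multiplied by [L] *)
pose d : R := (e / (2 + L * 2))%R.
have d0 : (0 < d)%R by rewrite divr_gt0// ltr_wpDr// mulr_ge0.
have [v_ [gv [[cvgv ugv] vle]]] := relaxation_exists_eps d0 Vv.
have [w_ [gw [[cvgw ugw] wle]]] := relaxation_exists_eps d0 Vw.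
have inA : compactly_inside (A `&` B) A' by exact: compactly_insideS ABin.
have inB : compactly_inside (A `&` B) B' by exact: compactly_insideS ABin.
have oAB : open (A `&` B) by exact: openI.
have mAB := open_mu_set mu_regular oAB.
have mvw i : mu_fun (A `&` B) (fun x => `|v_ i x - w_ i x|).
  by apply: mu_fun_abs_sub; apply: L1_fun; [case: cvgv => /(_ i _ inA)|case: cvgw => /(_ i _ inB)].
have /choice[h_ Hh] i := borel_envelope mu_regular mAB ABfin (mvw i) (fun x _ => abse_ge0 _).
pose G i x := (gv i \_ A) x + (gw i \_ B) x + ((fun y => L%:E * h_ i y) \_ (A `&` B)) x.
have rel : relaxation mu (A `|` B) (F v w) (fun i => F (v_ i) (w_ i)) G.
  split; first exact: glue_L1loc_cvg.
  move=> i; apply: upper_gradient_glue => //.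
  - exact: (upper_gradientS oA oA' AA' (ugv i)).
  - exact: (upper_gradientS oB oB' BB' (ugw i)).
  - by apply: (@measurable_funS _ _ _ _ setT) => //; case: (Hh i).
  - by case: (Hh i).
have oU : open (A `|` B) by exact: openU.
apply: (open_variation_le_near mu_regular oU rel).
have [cvgvAB cvgwAB] : (mu_int mu (A `&` B) (fun x => `|v_ i x - v x|) @[i --> \oo] --> 0)
    /\ (mu_int mu (A `&` B) (fun x => `|w_ i x - w x|) @[i --> \oo] --> 0).
  by case: cvgv => _ _ /(_ _ inA) ?; case: cvgw => _ _ /(_ _ inB).
have [mvi mv] : (forall i, mu_fun (A `&` B) (v_ i)) /\ mu_fun (A `&` B) v.
  by case: cvgv => h1 h2 _; split => [i|]; apply: L1_fun; [exact: h1|exact: h2].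
have [mwi mw] : (forall i, mu_fun (A `&` B) (w_ i)) /\ mu_fun (A `&` B) w.
  by case: cvgw => h1 h2 _; split => [i|]; apply: L1_fun; [exact: h1|exact: h2].
apply: filterS2 (cvge0_near_le cvgvAB d0) (cvge0_near_le cvgwAB d0) => i vd wd.
have [gv0 mgv _] := ugv i; have [gw0 mgw _] := ugw i.
have [mh h0 hge hint] := Hh i.
pose I := mu_int mu (A `&` B) (fun x => `|v x - w x|).
have hle : mu_int mu (A `&` B) (h_ i) <= I + (d + d)%:E.
  rewrite hint; apply: le_trans (mu_int_triangle mAB (mvi i) mv (mwi i)) _.
  apply: le_trans (leeD vd (mu_int_triangle mAB mv mw (mwi i))) _.
  rewrite addeCA EFinD; apply: leeD2l; apply: leeD => //.
  by apply: le_trans wd; rewrite /mu_int; under eq_integral do rewrite abse_subC.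
have mA := open_mu_set mu_regular oA; have mB := open_mu_set mu_regular oB.
have mU := open_mu_set mu_regular oU.
have restr (S : set X) (f : X -> \bar R) : S `<=` A `|` B ->
    mu_int mu (A `|` B) (f \_ S) = mu_int mu S f.
  move=> SU; rewrite /mu_int -integral_mkcondr; congr integral.
  by apply/seteqP; split => [x []//|x Sx]; split => //; exact: SU.
have mrestr (S : set X) (f : X -> \bar R) : mu_set S -> mu_fun S f ->
    mu_fun (A `|` B) (f \_ S).
  move=> mS mf; apply/(measurable_restrict _ mS mU).
  by apply: measurable_funS mf => //; exact: subIsetr.
have mgvA : mu_fun A (gv i).
  apply: (borel_mu_fun mu_regular (open_borel oA)).
  by apply: measurable_funS mgv => //; exact: open_borel.
have mgwB : mu_fun B (gw i).
  apply: (borel_mu_fun mu_regular (open_borel oB)).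
  by apply: measurable_funS mgw => //; exact: open_borel.
have mhAB : mu_fun (A `&` B) (h_ i).
  apply: (borel_mu_fun mu_regular (open_borel oAB)).
  by apply: measurable_funS mh => //; exact: open_borel.
have gvA0 x : 0 <= (gv i \_ A) x by apply: erestrict_ge0 => y /AA' /gv0.
have gwB0 x : 0 <= (gw i \_ B) x by apply: erestrict_ge0 => y /BB' /gw0.
have hAB0 x : 0 <= ((fun y => L%:E * h_ i y) \_ (A `&` B)) x.
  by apply: erestrict_ge0 => y _; rewrite mule_ge0 ?lee_fin.
have -> : mu_int mu (A `|` B) (G i) =
    mu_int mu A (gv i) + mu_int mu B (gw i) + L%:E * mu_int mu (A `&` B) (h_ i).
  rewrite /G mu_intD//; last 3 first.
  - by move=> x _; rewrite adde_ge0.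
  - by apply: emeasurable_funD; exact: mrestr.
  - by apply: mrestr => //; exact: measurable_funeM.
  rewrite mu_intD//; [|exact: mrestr|exact: mrestr].
  rewrite !restr; [|by move=> x []; left|by move=> x; right|by move=> x; left].
  congr (_ + _); rewrite /mu_int ge0_integralZl//.
have leA : mu_int mu A (gv i) <= open_variation mu A' v + d%:E.
  by apply: le_trans (vle i); exact: (ug_int_mono mu_regular oA' oA AA' (ugv i)).
have leB : mu_int mu B (gw i) <= open_variation mu B' w + d%:E.
  by apply: le_trans (wle i); exact: (ug_int_mono mu_regular oB' oB BB' (ugw i)).
apply: le_trans (leeD (leeD leA leB) (lee_wpmul2l _ hle)) _; first by rewrite lee_fin.
rewrite muleDr//; last by rewrite ge0_adde_def// inE ?lee_fin ?addr_ge0 ?mu_int_ge0// ltW.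
rewrite -/I (addeACA (open_variation mu A' v)) [leLHS]addeACA.
apply: leeD => //; rewrite -EFinM -!EFinD lee_fin.
have -> : (d + d + L * (d + d) = e)%R by rewrite /d; field; rewrite gt_eqF// ltr_wpDr// mulr_ge0.
by [].
Qed.

End glue_variation.
End variation_limits.

(** * Comparison of a function of least gradient *)

Section cutoff.
Context {R : realType} {X : completeMetricType R}.
Variables (rho : X -> R) (a : R).
Hypothesis a0 : (0 < a)%R.
Hypothesis rhoL : forall x y, (`|rho x - rho y| <= mdist x y)%R.

Definition cutoff x : R := Num.max 0%R (Num.min 1%R ((rho x - 3 * a) / a)%R).

Lemma cutoff01 x : (0 <= cutoff x <= 1)%R.
Proof. by rewrite /cutoff le_max lexx/= ge_max ler01/= ge_min lexx. Qed.

Lemma cutoff1 x : (4 * a < rho x)%R -> cutoff x = 1%R.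
Proof.
move=> h; rewrite /cutoff min_l ?max_r//.
by rewrite ler_pdivlMr//; lra.
Qed.

Lemma cutoff0 x : (rho x <= 3 * a)%R -> cutoff x = 0%R.
Proof.
move=> h; rewrite /cutoff; have h' : ((rho x - 3 * a) / a <= 0)%R.
  by rewrite ler_pdivrMr// mul0r; lra.
by rewrite min_r ?max_l// (le_trans h').
Qed.

Lemma cutoff_gt0 x : (3 * a < rho x)%R -> (0 < cutoff x)%R.
Proof.
move=> h; rewrite /cutoff lt_max lt_min ltr01/= divr_gt0 ?orbT//; lra.
Qed.

Lemma cutoff_lipschitz x y : (`|cutoff x - cutoff y| <= a^-1 * mdist x y)%R.
Proof.
have clamp (s t : R) : (`|Num.max 0 (Num.min 1 s) - Num.max 0 (Num.min 1 t)| <= `|s - t|)%R.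
  rewrite ler_norml.
  by case: (leP 1%R s) => h1; case: (leP 1%R t) => h2; rewrite ?[Num.max 0%R 1%R]max_r//;
    try case: (leP 0%R s) => h3; try case: (leP 0%R t) => h4;
    case: (ler0P (s - t)%R) => h5; apply/andP; split; lra.
apply: le_trans (clamp _ _) _.
have -> : ((rho x - 3 * a) / a - (rho y - 3 * a) / a = a^-1 * (rho x - rho y))%R.
  by field; rewrite gt_eqF.
by rewrite normrM gtr0_norm ?invr_gt0// ler_wpM2l// invr_ge0 ltW.
Qed.

Lemma level_continuous : continuous rho.
Proof. by apply: (@lipschitz_continuous _ _ _ 1%R) => // x y; rewrite mul1r. Qed.

Lemma open_superlevel (c : R) : open [set x | (c < rho x)%R].
Proof. exact/open_lt_fun/level_continuous. Qed.

Lemma open_sublevel (c : R) : open [set x | (rho x < c)%R].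
Proof. exact/open_gt_fun/level_continuous. Qed.

Lemma closure_superlevel (c : R) :
  closure [set x | (c < rho x)%R] `<=` [set x | (c <= rho x)%R].
Proof.
rewrite [X in _ `<=` X](closure_id _).1; last exact/closed_le_fun/level_continuous.
by apply: closure_subset => x /= /ltW.
Qed.

Lemma closure_sublevel (c : R) :
  closure [set x | (rho x < c)%R] `<=` [set x | (rho x <= c)%R].
Proof.
rewrite [X in _ `<=` X](closure_id _).1; last exact/closed_ge_fun/level_continuous.
by apply: closure_subset => x /= /ltW.
Qed.

End cutoff.

Lemma avoid_countable (R : realType) (C : set R) (d : R) : countable C ->
  (0 < d)%R -> exists2 e : R, (0 < e < d)%R & ~ C e.
Proof.
move=> cC d0; apply: contrapT => nex.
have sub : `]0%R, d[%classic `<=` C.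
  move=> e /=; rewrite in_itv/= => ed; apply: contrapT => nCe.
  by apply: nex; exists e.
have : countable `]0%R, d[%classic by exact: sub_countable (subset_card_le sub) cC.
move=> /countable_lebesgue_measure0; rewrite lebesgue_measure_itv/= lte_fin d0.
by rewrite oppr0 adde0 => -[] d0'; move: d0; rewrite d0' ltxx.
Qed.

Section least_gradient.
Context {R : realType} {X : completeMetricType R}.
Variable mu : {outer_measure set X -> \bar R}.
Hypothesis mu_regular : borel_regular mu.
Hypothesis mu_doubling : doubling mu.
Implicit Types (A B D U W : set X).

Local Notation muC := (mu : set (caratheodory_type mu) -> \bar R).
Local Notation mu_fun D f := (measurable_fun
  (D : set (caratheodory_type mu)) (f : caratheodory_type mu -> \bar R)).
Local Notation mu_set D := (measurable (D : set (caratheodory_type mu))).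

Lemma L1_fine D v : mu_set D -> L1 mu D v ->
  L1 mu D (fun x => (fine (v x))%:E) /\
  exists N, mu N = 0 /\ forall x, D x -> ~ N x -> v x = (fine (v x))%:E.
Proof.
move=> mD Lv; split.
  apply: (le_integrable mD _ _ Lv).
    apply/measurable_EFinP; apply: measurableT_comp => //.
    exact: L1_fun.
  by move=> x _; case: (v x) => [r||]//=; rewrite leey.
have [N [mN N0 HN]] := integrable_ae mD Lv.
exists N; split=> // x Dx nNx; rewrite fineK//.
apply: contrapT => nfin; apply: nNx; apply: HN => /= /(_ Dx).
exact: nfin.
Qed.

Lemma L1_cst D (c : R) : mu_set D -> mu D < +oo -> L1 mu D (cst c%:E).
Proof.
move=> mD Dfin; apply/integrableP; split; first exact: measurable_cst.
rewrite (_ : (fun x => _) = cst `|c|%:E)//.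
by rewrite integral_cst//= lte_mul_pinfty// lee_fin.
Qed.


Lemma variation_lt_exists Omega w K (t : \bar R) : Defs.variation mu Omega w K < t ->
  exists W, [/\ open W, K `<=` W, W `<=` Omega & open_variation mu W w < t].
Proof. by move=> /ereal_inf_lt[_ [W [oW KW WO] <-] Vt]; exists W. Qed.

Lemma variation_le_open Omega w K W : open W -> K `<=` W -> W `<=` Omega ->
  Defs.variation mu Omega w K <= open_variation mu W w.
Proof. by move=> oW KW WO; apply: ereal_inf_lbound; exists W. Qed.

Section competitor.
Variables (Omega U : set X) (w v : X -> \bar R) (rho : X -> R) (a : R).
Hypothesis (oOmega : open Omega) (oU : open U) (UOmega : U `<=` Omega).
Hypothesis w_least : least_gradient mu Omega w.
Hypothesis v_fin : open_variation mu U v < +oo.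
Hypothesis a0 : (0 < a)%R.
Hypothesis rhoL : forall x y, (`|rho x - rho y| <= mdist x y)%R.
Hypothesis rho_compact : compact [set x | (a <= rho x)%R].
Hypothesis rho_in : [set x | (a <= rho x)%R] `<=` U.

Let eta := cutoff rho a.
Let U' := [set x | (a < rho x)%R].
Let Z := [set x | (2 * a < rho x)%R] `&` [set x | (rho x < 5 * a)%R].
Let wE x : \bar R := (fine (w x))%:E.

Let oU' : open U'. Proof. exact: open_superlevel. Qed.
Let mU' : mu_set U'. Proof. exact: open_mu_set. Qed.

Let superlevel_in (c : R) V : (a <= c)%R -> [set x | (c <= rho x)%R] `<=` V ->
  compactly_inside [set x | (c < rho x)%R] V.
Proof.
move=> ac cV; have sub := @closure_superlevel _ _ rho rhoL c.
split; first exact: open_superlevel; last by move=> x /sub /cV.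
apply: (@subclosed_compact _ _ [set x | (a <= rho x)%R]) => //.
  exact: closed_closure.
by move=> x /sub /= ; exact: le_trans.
Qed.

Let U'_in : compactly_inside U' U.
Proof. exact: superlevel_in. Qed.

Let U'_inOmega : compactly_inside U' Omega.
Proof. exact: compactly_insideS U'_in. Qed.

Let U'fin : mu U' < +oo.
Proof. exact: compactly_inside_finite U'_in. Qed.

Let Z_sub : Z `<=` U'.
Proof. by have a1 := a0; move=> x [/= h _]; rewrite /U' /=; lra. Qed.

Let oZ : open Z.
Proof. by apply: openI; [exact: open_superlevel|exact: open_sublevel]. Qed.

Let Lw : L1 mu U' w.
Proof. by have [BVw _] := w_least; have [] := BVw _ U'_inOmega. Qed.

Let Vw : open_variation mu U' w < +oo.
Proof. by have [BVw _] := w_least; have [] := BVw _ U'_inOmega. Qed.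

Let Lv : L1 mu U' v.
Proof. exact: (open_variation_L1loc v_fin). Qed.

Let Vv : open_variation mu U' v < +oo.
Proof.
apply: le_lt_trans v_fin; apply: (open_variationS mu_regular) => //.
exact: compactly_inside_sub U'_in.
Qed.

Let LwE : L1 mu U' wE. Proof. by have [] := L1_fine mU' Lw. Qed.

Let eta01 x : (0 <= eta x <= 1)%R. Proof. exact: cutoff01. Qed.
Let ainv0 : (0 <= a^-1)%R. Proof. by rewrite invr_ge0 ltW. Qed.
Let etaL x y : (`|eta x - eta y| <= a^-1 * mdist x y)%R.
Proof. exact: cutoff_lipschitz. Qed.

Let near1 x : (5 * a <= rho x)%R -> \forall y \near x, eta y = 1%R.
Proof.
have a1 := a0; move=> hx; have : nbhs x [set y | (4 * a < rho y)%R].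
  by apply: open_nbhs_nbhs; split; [exact: open_superlevel|rewrite /=; lra].
by apply: filterS => y /= h; exact: cutoff1.
Qed.

Let near0 x : (rho x <= 2 * a)%R -> \forall y \near x, eta y = 0%R.
Proof.
have a1 := a0; move=> hx; have : nbhs x [set y | (rho y < 3 * a)%R].
  by apply: open_nbhs_nbhs; split; [exact: open_sublevel|rewrite /=; lra].
by apply: filterS => y /= /ltW h; exact: cutoff0.
Qed.

Section shifted.
Variable e : R.

Let vE x : \bar R := (fine (v x) + e)%:E.

Let LvE : L1 mu U' vE.
Proof.
have [Lv' _] := L1_fine mU' Lv.
exact: (integrableD mU' Lv' (L1_cst e mU' U'fin)).
Qed.

Let VwE V : open V -> V `<=` U' -> open_variation mu V wE <= open_variation mu V w.
Proof.
move=> oV VU'; have [_ [N [N0 HN]]] := L1_fine mU' Lw.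
apply: (open_variation_ae mu_regular oV N0).
  by move=> x /VU' Ux nNx; exact: HN.
exact: (L1_L1loc mu_regular oV (L1S mu_regular oU' oV VU' LwE)).
Qed.

Let VvE V : open V -> V `<=` U' -> open_variation mu V vE <= open_variation mu V v.
Proof.
move=> oV VU'; have [Lv' [N [N0 HN]]] := L1_fine mU' Lv.
have Lloc (f : X -> \bar R) : L1 mu U' f -> L1loc mu V f.
  by move=> Lf; exact: (L1_L1loc mu_regular oV (L1S mu_regular oU' oV VU' Lf)).
have Vvfin : open_variation mu V (fun x => (fine (v x))%:E) <= open_variation mu V v.
  apply: (open_variation_ae mu_regular oV N0); last exact: Lloc.
  by move=> x /VU' Ux nNx; exact: HN.
have Vc : open_variation mu V (cst (- e)%:E) = 0.
  by apply: (open_variation_cst mu_regular oV); apply: Lloc; exact: L1_cst.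
have Vlt : open_variation mu V v < +oo.
  by apply: le_lt_trans Vv; exact: open_variationS.
have -> : vE = (fun x => (fine (v x))%:E - (cst (- e)%:E x)).
  by apply/funext => x; rewrite /vE /= opprK.
apply: le_trans (open_variationB mu_regular oV _ _) _.
- exact: le_lt_trans Vvfin Vlt.
- by rewrite Vc.
- by rewrite Vc adde0.
Qed.

(** The vanishing second term gives it the form of the functions handled by
    [open_variation_glue], which proves that it is in BV. *)
Definition perturbation x : \bar R :=
  (eta x)%:E * (vE x - wE x) + (1 - eta x)%:E * cst 0 x.

Let perturbationE x : perturbation x = (eta x)%:E * (vE x - wE x).
Proof. by rewrite /perturbation mule0 adde0. Qed.

Let perturbation_out x : ~ U' x -> perturbation x = 0.
Proof.
have a1 := a0; move=> nUx; rewrite perturbationE /eta cutoff0 ?mul0e//.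
by rewrite leNgt; apply/negP => h; apply: nUx; rewrite /U' /=; lra.
Qed.

Let perturbation_L1 : L1 mu setT perturbation.
Proof.
have -> : perturbation = (fun x => (eta x)%:E * (vE x - wE x)) \_ U'.
  apply/funext => x; rewrite patchE; case: ifPn; rewrite ?notin_setE.
    by move=> _; exact: perturbationE.
  exact: perturbation_out.
rewrite /L1 -(integrable_mkcond _ mU').
have LB : L1 mu U' (fun x => vE x - wE x) by exact: integrableB.
apply: (le_integrable mU' _ _ LB).
  apply: emeasurable_funM; last exact: L1_fun LB.
  apply: (continuous_mu_fun mu_regular _ mU').
  exact: (lipschitz_continuous ainv0 etaL).
move=> x _; have /andP[h0 h1] := eta01 x.
rewrite abseM abse_EFin ger0_norm//.
by apply: gee_pMl => //; rewrite ?lee_fin.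
Qed.

Let vE_wE_variation : open_variation mu U' (fun x => vE x - wE x) < +oo.
Proof.
have Vw' := VwE oU' (@subset_refl _ U'); have Vv' := VvE oU' (@subset_refl _ U').
apply: le_lt_trans (open_variationB mu_regular oU' _ _) _.
- exact: le_lt_trans Vv' Vv.
- exact: le_lt_trans Vw' Vw.
- by apply: lte_add_pinfty; [exact: le_lt_trans Vv' Vv|exact: le_lt_trans Vw' Vw].
Qed.

Let closure_Z x : closure Z x -> (2 * a <= rho x)%R /\ (rho x <= 5 * a)%R.
Proof.
move=> /closureI[cx dx]; split.
  exact: (closure_superlevel rhoL cx).
exact: (closure_sublevel rhoL dx).
Qed.

Let compact_closure_Z : compact (closure Z).
Proof.
apply: (@subclosed_compact _ _ [set x | (a <= rho x)%R]) => //.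
  exact: closed_closure.
by have a1 := a0; move=> x /closure_Z[/= h _]; lra.
Qed.

Let mZ : mu_set Z. Proof. exact: open_mu_set. Qed.

Let Zfin : mu Z < +oo.
Proof. by apply: le_lt_trans U'fin; exact: le_outer_measure. Qed.

Let perturbation_variation : open_variation mu setT perturbation < +oo.
Proof.
have a1 := a0.
have EAB : [set x | (2 * a < rho x)%R] `|` [set x | (rho x < 5 * a)%R] = setT.
  apply/seteqP; split=> // x _ /=.
  by case: (ltP (2 * a)%R (rho x)) => h; [left|right; lra].
have L0 : L1loc mu setT (cst 0).
  move=> V Vin; apply: L1_cst; first by apply: open_mu_set => //; case: Vin.
  exact: (compactly_inside_finite mu_doubling Vin).
have V0 := open_variation_cst mu_regular openT L0.
have AU : [set x | (2 * a < rho x)%R] `<=` U' by move=> x /= h; rewrite /U' /=; lra.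
have Zin : compactly_inside Z (U' `&` setT).
  split => // x /closure_Z[h _]; split => //=; rewrite /U' /=; lra.
have AB1 x : (2 * a < rho x)%R -> ~ (rho x < 5 * a)%R -> \forall y \near x, eta y = 1%R.
  by move=> _ /negP; rewrite -leNgt; exact: near1.
have AB0 x : (rho x < 5 * a)%R -> ~ (2 * a < rho x)%R -> \forall y \near x, eta y = 0%R.
  by move=> _ /negP; rewrite -leNgt; exact: near0.
have V0lt : open_variation mu setT (cst 0) < +oo by rewrite V0.
have := open_variation_glue mu_regular (open_superlevel rhoL _) (open_sublevel rhoL _)
  oU' openT AU (@subsetT _ _) Zin Zfin ainv0 eta01 etaL AB1 AB0 vE_wE_variation V0lt.
rewrite EAB => glue; apply: le_lt_trans glue _.
rewrite V0 adde0; apply: lte_add_pinfty; first exact: vE_wE_variation.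
apply: lte_mul_pinfty; [by rewrite lee_fin|by []|].
have LB : L1 mu U' (fun x => vE x - wE x) by exact: integrableB.
have /integrableP[_] := L1S mu_regular oU' oZ Z_sub LB.
by under eq_integral do rewrite -(sube0 (vE _ - wE _)).
Qed.

Variable D : set X.
Hypothesis D_dense : forall x (r : R), (0 < r)%R -> U' x ->
  exists2 y, D y & ball x r y.
Hypothesis D_avoid : forall y, D y -> (fine (v y) + e)%R <> fine (w y).

Let H := closure [set x | (3 * a < rho x)%R].

(** By the choice of [e] the perturbation vanishes on no open subset of
    [{3 * a < rho}], so that its support is known exactly. *)
Let perturbation_support : fun_support perturbation = H.
Proof.
have a1 := a0; apply/seteqP; split.
  apply: closure_subset => x /=; rewrite perturbationE; apply: contraNP => /negP.
  by rewrite -leNgt => h; rewrite /eta cutoff0// mul0e.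
rewrite [X in _ `<=` X](closure_id _).1; last exact: closed_closure.
apply: closure_subset => x /= x3 B nB.
have nB3 : nbhs x (B `&` [set y | (3 * a < rho y)%R]).
  apply: filterI nB _; apply: open_nbhs_nbhs; split=> //.
  exact: open_superlevel.
have [r /= r0 rB] := (@nbhs_ballP _ _ _ _).1 nB3.
have [|y Dy xy] := D_dense r0 (_ : U' x); first by rewrite /U' /=; lra.
have [By /= y3] := rB y xy.
exists y; split => //; rewrite /= perturbationE /vE /wE -EFinB -EFinM.
apply/eqP => -[] /eqP; rewrite mulf_eq0 => /orP[/eqP h|].
  by have := cutoff_gt0 a1 y3; rewrite -/eta h ltxx.
by rewrite subr_eq0 => /eqP; exact: D_avoid.
Qed.

Let H_sub x : H x -> (3 * a <= rho x)%R.
Proof. exact: closure_superlevel. Qed.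

Let compact_H : compact H.
Proof.
apply: (@subclosed_compact _ _ [set x | (a <= rho x)%R]) => //.
  exact: closed_closure.
by have a1 := a0; move=> x /H_sub /= h; lra.
Qed.

Let HU' : H `<=` U'.
Proof. by have a1 := a0; move=> x /H_sub h; rewrite /U' /=; lra. Qed.

Let U'Omega : U' `<=` Omega.
Proof. exact: compactly_inside_sub U'_inOmega. Qed.

Let perturbation_BVc : BVc mu Omega perturbation.
Proof.
split; rewrite ?perturbation_support//.
by move=> x /HU'/U'Omega.
Qed.

(** The competitor is [w + perturbation]. Both [W1] and its compactly contained
    part [W0] are neighbourhoods of the support of [perturbation]: the variation of
    the competitor is estimated on [W0], from approximations on [W1]. *)
Lemma shifted_competitor :
  open_variation mu [set x | (6 * a < rho x)%R] w <=
  open_variation mu U v + a^-1%:E * mu_int mu Z (fun x => `|vE x - wE x|).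
Proof.
have a1 := a0; apply/lee_addgt0Pr => d d0.
have LB : L1 mu U' (fun x => vE x - wE x) by exact: integrableB.
have Hw_fin : Defs.variation mu Omega w H \is a fin_num.
  rewrite ge0_fin_numE; last first.
    by apply: le_ereal_inf_tmp => _ [V _ <-]; exact: open_variation_ge0.
  by apply: le_lt_trans Vw; exact: variation_le_open.
have [W [oW HW WO Wle]] : exists W, [/\ open W, H `<=` W, W `<=` Omega &
    open_variation mu W w < Defs.variation mu Omega w H + d%:E].
  by apply: variation_lt_exists; rewrite lteDl.
pose W1 := W `&` U'; have oW1 : open W1 by exact: openI.
have HW1 : H `<=` W1 by move=> x Hx; split; [exact: HW|exact: HU'].
have W1U' : W1 `<=` U' by move=> x [].
have [W0 [HW0 W0in]] := compact_neighborhood mu_regular mu_doubling compact_H oW1 HW1.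
have oW0 : open W0 by case: W0in.
have W01 := compactly_inside_sub W0in.
pose B6 := W1 `&` [set x | (rho x < 6 * a)%R].
have oB6 : open B6 by apply: openI => //; exact: open_sublevel.
have B6U' : B6 `<=` U' by move=> x [/W1U'].
pose A := W0 `&` [set x | (2 * a < rho x)%R].
pose B := W0 `&` [set x | (rho x < 5 * a)%R].
have oA : open A by apply: openI => //; exact: open_superlevel.
have oB : open B by apply: openI => //; exact: open_sublevel.
have EAB : A `|` B = W0.
  apply/seteqP; split=> [x [[]|[]]//|x W0x].
  by case: (ltP (2 * a)%R (rho x)) => h; [left|right]; split=> //=; lra.
have ABZ : A `&` B `<=` Z by move=> x [[_ ?] [_ ?]].
have ABin : compactly_inside (A `&` B) (W1 `&` B6).
  have sub : closure (A `&` B) `<=` W1 `&` B6.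
    move=> x cx; have /closure_Z[_ h5] : closure Z x by exact: closure_subset cx.
    have W1x : W1 x.
      by case: W0in => _ _; apply; apply: closure_subset cx => y [[]].
    by do 2 split=> //; rewrite /=; lra.
  split=> //; first exact: openI.
  apply: (@subclosed_compact _ _ (closure Z)) => //; first exact: closed_closure.
  exact: closure_subset.
have VvW1 : open_variation mu W1 vE <= open_variation mu U v.
  apply: le_trans (VvE oW1 W1U') _; apply: (open_variationS mu_regular) => //.
  by move=> x /W1U'; exact: compactly_inside_sub U'_in x.
have VwB6 := VwE oB6 B6U'.
have B6fin : open_variation mu B6 w < +oo.
  by apply: le_lt_trans Vw; exact: open_variationS.
have AW1 : A `<=` W1 by move=> x [/W01].
have BB6 : B `<=` B6 by move=> x [/W01 W1x /= h]; split=> //=; lra.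
have AB1 x : A x -> ~ B x -> \forall y \near x, eta y = 1%R.
  by move=> [W0x _] nB; apply: near1; rewrite leNgt; apply/negP => h; apply: nB.
have AB0 x : B x -> ~ A x -> \forall y \near x, eta y = 0%R.
  by move=> [W0x _] nA; apply: near0; rewrite leNgt; apply/negP => h; apply: nA.
have glue := open_variation_glue mu_regular oA oB oW1 oB6 AW1 BB6 ABin
  (le_lt_trans (le_outer_measure mu _ _ ABZ) Zfin) ainv0 eta01 etaL AB1 AB0
  (le_lt_trans VvW1 v_fin) (le_lt_trans VwB6 B6fin).
rewrite EAB in glue.
have {}glue : open_variation mu W0
    (fun x => (eta x)%:E * vE x + (1 - eta x)%:E * wE x) <=
    open_variation mu U v + open_variation mu B6 w +
    a^-1%:E * mu_int mu Z (fun x => `|vE x - wE x|).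
  have mAB : mu_set (A `&` B) by apply: open_mu_set => //; exact: openI.
  have mvw := mu_fun_abs_sub (L1_fun (L1S mu_regular oU' oZ Z_sub LvE))
    (L1_fun (L1S mu_regular oU' oZ Z_sub LwE)).
  have int_le := mu_intS mZ mAB ABZ mvw (fun x _ => abse_ge0 _).
  apply: le_trans glue _; apply: (leeD (leeD VvW1 VwB6)).
  by apply: (lee_wpmul2l _ int_le); rewrite lee_fin.
have wf : open_variation mu W0 (fun x => w x + perturbation x) <=
    open_variation mu W0 (fun x => (eta x)%:E * vE x + (1 - eta x)%:E * wE x).
  have [_ [N [N0 HN]]] := L1_fine mU' Lw.
  have W0U' : W0 `<=` U' by move=> x /W01 /W1U'.
  apply: (open_variation_ae mu_regular oW0 N0).
    move=> x /W0U' Ux nNx; rewrite (HN x Ux nNx) perturbationE /vE /wE.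
    by rewrite -EFinB -!EFinM -!EFinD; congr EFin; ring.
  apply: (L1_L1loc mu_regular oW0); apply: (integrableD (open_mu_set mu_regular oW0)).
    exact: (L1S mu_regular oU' oW0 W0U' Lw).
  exact: (L1S mu_regular openT oW0 (@subsetT _ W0) perturbation_L1).
have least := w_least.2 _ perturbation_BVc; rewrite perturbation_support in least.
have test : Defs.variation mu Omega (fun x => w x + perturbation x) H <=
    open_variation mu W0 (fun x => w x + perturbation x).
  by apply: variation_le_open => // x /W01/W1U'/U'Omega.
have o6 : open [set x | (6 * a < rho x)%R] by exact: open_superlevel.
have split_ : open_variation mu [set x | (6 * a < rho x)%R] w +
    open_variation mu B6 w <= open_variation mu W w.
  apply: (open_variation_disjoint mu_regular) => //.
  - by move=> x /= h; apply: HW; apply: subset_closure => /=; lra.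
  - by move=> x [[]].
  - by apply/seteqP; split=> // x [/= h1 [_ /= h2]]; lra.
have total : open_variation mu [set x | (6 * a < rho x)%R] w +
    open_variation mu B6 w <= (open_variation mu U v +
    a^-1%:E * mu_int mu Z (fun x => `|vE x - wE x|) + d%:E) + open_variation mu B6 w.
  apply: le_trans split_ _; apply: le_trans (ltW Wle) _.
  rewrite -addeA (addeC d%:E) addeA; apply: leeD => //.
  apply: le_trans least _; apply: le_trans test _; apply: le_trans wf _.
  by apply: le_trans glue _; rewrite addeAC.
by move: total; rewrite leeD2rE// open_variation_fin.
Qed.

End shifted.

(** Countably many values of [e] are excluded by the condition of
    [shifted_competitor], so [e] can tend to [0]. *)
Lemma competitor :
  open_variation mu [set x | (6 * a < rho x)%R] w <=
  open_variation mu U v + a^-1%:E * mu_int mu Z (fun x => `|v x - w x|).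
Proof.
have a1 := a0.
have Zfin : mu Z < +oo by apply: le_lt_trans U'fin; exact: le_outer_measure.
have mZ : mu_set Z by exact: open_mu_set.
have Zfin' : mu Z \is a fin_num by rewrite ge0_fin_numE.
apply/lee_addgt0Pr => d d0.
have [M M0 rhoM] := compact_sub_ball (point : X) rho_compact.
have [D cD D_dense] := @separable_bounded _ _ _ mu_regular mu_doubling (point : X) M M0.
pose q : R := (a * d / (fine (mu Z) + 1))%R.
have q1 : (0 < fine (mu Z) + 1)%R by rewrite ltr_wpDl// fine_ge0.
have q0 : (0 < q)%R by rewrite divr_gt0// mulr_gt0.
have cC : countable [set (fine (w y) - fine (v y))%R | y in D].
  exact: (sub_countable (card_image_le _ _) cD).
have [e /andP[e0 eq] eC] := avoid_countable cC q0.
have dens x (r : R) : (0 < r)%R -> U' x -> exists2 y, D y & ball x r y.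
  move=> r0 Ux; apply: D_dense => //; apply: rhoM; exact: ltW.
have avoid y : D y -> (fine (v y) + e)%R <> fine (w y).
  by move=> Dy h; apply: eC; exists y => //; rewrite -h; ring.
have h := @shifted_competitor e D dens avoid; apply: le_trans h _.
rewrite -addeA; apply: leeD => //.
have Lwz := L1_fun (L1S mu_regular oU' oZ Z_sub Lw).
have Lvz := L1_fun (L1S mu_regular oU' oZ Z_sub Lv).
have mvw := mu_fun_abs_sub Lvz Lwz.
have int_le : mu_int mu Z (fun x => `|(fine (v x) + e)%:E - wE x|) <=
    mu_int mu Z (fun x => `|v x - w x|) + mu_int mu Z (cst e%:E).
  apply: mu_int_dominated => //.
  - apply: mu_fun_abs_sub.
      by apply/measurable_EFinP; apply: measurable_funD => //; exact: measurableT_comp.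
    by apply/measurable_EFinP; exact: measurableT_comp.
  - by move=> x _; rewrite lee_fin ltW.
  move=> x _; rewrite /wE; case: (v x) (w x) => [r||] [s||]; rewrite ?leey//=.
  rewrite -EFinD lee_fin; have -> : (r + e - s = (r - s) + e)%R by ring.
  by apply: le_trans (ler_normD _ _) _; rewrite (gtr0_norm e0).
apply: le_trans (lee_wpmul2l _ int_le) _; first by rewrite lee_fin.
rewrite muleDr//; last by rewrite ge0_adde_def// inE mu_int_ge0// => *; rewrite lee_fin ltW.
apply: leeD => //; rewrite /mu_int integral_cst//= -(fineK Zfin') -!EFinM lee_fin.
rewrite mulrC ler_pdivrMr// mulrC.
have : (e * (fine (mu Z) + 1) <= a * d)%R by rewrite -ler_pdivlMr// ltW.
by rewrite mulrDr mulr1; lra.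
Qed.

End competitor.
End least_gradient.

(** * Limits of functions of least gradient *)

Section limit.
Context {R : realType} {X : completeMetricType R}.
Variable mu : {outer_measure set X -> \bar R}.
Hypotheses (mu_regular : borel_regular mu) (mu_doubling : doubling mu).
Variables (Omega : set X) (u_ : nat -> X -> \bar R) (u : X -> \bar R).
Hypothesis open_Omega : open Omega.
Hypothesis u_least : forall k, least_gradient mu Omega (u_ k).
Hypothesis u_cvg : L1loc_cvg mu Omega u_ u.

(** [competitor] for [u_ k], passed to the limit. As [Z] is disjoint from [K], it
    does not see modifications of [u] inside [K]. *)
Lemma limit_variation U K v : open U -> U `<=` Omega -> compact K -> K `<=` U ->
  open_variation mu U v < +oo ->
  exists A Z (a : R), [/\ open A, K `<=` A, A `<=` U,
    [/\ compactly_inside Z U, Z `&` K = set0 & (0 < a)%R] &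
    forall c : \bar R,
      (\forall k \near \oo, mu_int mu Z (fun x => `|v x - u_ k x|) <= c) ->
      open_variation mu A u <= open_variation mu U v + a^-1%:E * c].
Proof.
move=> oU UO cK KU Vv.
have [rho [a [a0 rhoL rhoC rhoU rhoK]]] := cutoff_level mu_regular mu_doubling cK oU KU.
pose A := [set x | (6 * a < rho x)%R].
pose Z := [set x | (2 * a < rho x)%R] `&` [set x | (rho x < 5 * a)%R].
have oA : open A by exact: open_superlevel.
have clA : closure A `<=` [set x | (a <= rho x)%R].
  by move=> x /(closure_superlevel rhoL)/= h; lra.
have clZ : closure Z `<=` [set x | (a <= rho x)%R].
  by move=> x /closureI[/(closure_superlevel rhoL)/= h _]; lra.
have AU : compactly_inside A U.
  split=> //; last by move=> x /clA /rhoU.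
  by apply: (@subclosed_compact _ _ [set x | (a <= rho x)%R]) => //; exact: closed_closure.
have ZU : compactly_inside Z U.
  split; last by move=> x /clZ /rhoU.
    by apply: openI; [exact: open_superlevel|exact: open_sublevel].
  by apply: (@subclosed_compact _ _ [set x | (a <= rho x)%R]) => //; exact: closed_closure.
exists A, Z, a; split=> //; first exact: compactly_inside_sub.
  by split=> //; apply/seteqP; split=> // x [[_ /= h] /rhoK]; lra.
move=> c uc; have AO := compactly_insideS UO AU.
have [Luk Lu cvgu] := u_cvg.
apply: (lower_semicontinuity mu_regular mu_doubling oA _ (fun k => Luk k _ AO)
  (Lu _ AO) (cvgu _ AO)).
  by case: AU.
apply: filterS uc => k uc.
have := competitor mu_regular mu_doubling oU UO (u_least k) Vv a0 rhoL rhoC rhoU.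
rewrite -/Z -/A => h; apply: le_trans h _; apply: leeD2l; apply: lee_wpmul2l => //.
by rewrite lee_fin invr_ge0 ltW.
Qed.

(** Comparison with [v = 0], that is, the Caccioppoli inequality. *)
Lemma limit_BVloc : BVloc mu Omega u.
Proof.
move=> V VO; have [oV cV clVO] := VO; have [Luk Lu cvgu] := u_cvg.
split; first exact: Lu.
have L0 : L1loc mu Omega (cst 0).
  move=> W WO; apply: L1_cst; first by apply: open_mu_set => //; case: WO.
  exact: (compactly_inside_finite mu_doubling WO).
have V0 := open_variation_cst mu_regular open_Omega L0.
have [|A [Z [a [oA VA AO [ZO _ a0] HA]]]] :=
    limit_variation open_Omega (@subset_refl _ Omega) cV clVO (v := cst 0).
  by rewrite V0.
have oZ : open Z by case: ZO.
have mZ := open_mu_set mu_regular oZ.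
have c_fin : mu_int mu Z (fun x => `|u x|) + 1%:E < +oo.
  by rewrite lte_add_pinfty ?ltry//; have /integrableP[] := Lu Z ZO.
apply: (@le_lt_trans _ _ (open_variation mu A u)).
  apply: (open_variationS mu_regular) => // x Vx; apply: VA; exact: subset_closure.
apply: le_lt_trans (HA (mu_int mu Z (fun x => `|u x|) + 1%:E) _) _; last first.
  by rewrite V0 add0e; apply: lte_mul_pinfty => //; rewrite lee_fin invr_ge0 ltW.
apply: filterS (cvge0_near_le (cvgu Z ZO) ltr01) => k uk.
have mu0 : measurable_fun (Z : set (caratheodory_type mu))
  (cst 0 : caratheodory_type mu -> \bar R) by exact: measurable_cst.
have tri := mu_int_triangle mZ mu0 (L1_fun (Lu Z ZO)) (L1_fun (Luk k Z ZO)).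
have E1 : mu_int mu Z (fun x => `|cst 0 x - u x|) = mu_int mu Z (fun x => `|u x|).
  by apply: eq_integral => x _; rewrite /= sub0e abseN.
have E2 : mu_int mu Z (fun x => `|u x - u_ k x|) = mu_int mu Z (fun x => `|u_ k x - u x|).
  by apply: eq_integral => x _; exact: abse_subC.
by rewrite E1 E2 in tri; apply: le_trans tri _; exact: leeD2l.
Qed.

(** Comparison with [v = u + g], which is [u] on [Z]. *)
Lemma limit_minimal g : BVc mu Omega g ->
  Defs.variation mu Omega u (fun_support g) <=
  Defs.variation mu Omega (fun x => u x + g x) (fun_support g).
Proof.
move=> [_ cK KO]; have [Luk Lu cvgu] := u_cvg.
apply: le_ereal_inf_tmp => _ [U [oU KU UO] <-].
set v := fun x => u x + g x; set K := fun_support g in cK KO KU *.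
have [->|Vfin] := eqVneq (open_variation mu U v) +oo; first exact: leey.
have Vlt : open_variation mu U v < +oo by rewrite ltey.
have [A [Z [a [oA KA AU [ZU ZK a0] HA]]]] := limit_variation oU UO cK KU Vlt.
apply: (@le_trans _ _ (open_variation mu A u)).
  by apply: variation_le_open => // x /AU /UO.
apply/lee_addgt0Pr => d d0.
have ad0 : (0 < a * d)%R by rewrite mulr_gt0.
have -> : d%:E = a^-1%:E * (a * d)%:E.
  by rewrite -EFinM mulKf// gt_eqF.
apply: HA; have ZO := compactly_insideS UO ZU.
apply: filterS (cvge0_near_le (cvgu Z ZO) ad0) => k; apply: le_trans.
rewrite /mu_int le_eqVlt; apply/orP; left; apply/eqP; apply: eq_integral => x.
rewrite inE => Zx; rewrite abse_subC; congr (`|_ - _|).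
rewrite /v (_ : g x = 0) ?adde0//.
apply/eqP/negPn/negP => gx; suff : (Z `&` K) x by rewrite ZK.
by split=> //; exact: subset_closure.
Qed.

End limit.

Theorem proposition3p1 (R : realType) (X : completeMetricType R)
  (mu : {outer_measure set X -> \bar R})
  (mu_regular : borel_regular mu)
  (mu_doubling : doubling mu)
  (mu_poincare : poincare11 mu)
  (Omega : set X) (Omega_open : open Omega)
  (u_ : nat -> X -> \bar R) (u : X -> \bar R)
  (u_least : forall k, least_gradient mu Omega (u_ k))
  (u_cvg : L1loc_cvg mu Omega u_ u) :
  least_gradient mu Omega u.
Proof.
split; first exact: (limit_BVloc mu_regular mu_doubling Omega_open u_least u_cvg).
exact: (limit_minimal mu_regular mu_doubling u_least u_cvg).
Qed.
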